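(* Let $X$ be a smooth projective variety over $\mathbb{C}$ and $B\subset X$ a smooth divisor. Let $d$ be a positive integer, let $M$ be a line bundle on $X$ such that $\mathcal{O}_X(dM)\cong\mathcal{O}_X(B)$, and let $\pi:Y\to X$ be the cyclic covering of degree $d$ defined by $M$ (and branched along $B$). Let $L$ be a line bundle on $X$ and $k$ a non-negative integer. If $L-qM$ is $\sigma(k,d,q)$-very ample for every $q=0,\ldots,\min(k,d-1)$, then $\pi^*L$ is $k$-very ample on $Y$.
   Context: All varieties are over the field $\mathbb{C}$. Tensor products and powers of line bundles are written additively, so $L-qM$ means $L\otimes M^{\otimes(-q)}$ and $\mathcal{O}_X(dM)=M^{\otimes d}$. Cyclic covering: let $\overline{M}$ be the total space of $M$, $p:\overline{M}\to X$ the bundle projection, $s_B\in H^0(X,\mathcal{O}_X(B))$ a section with divisor of zeros $B$ (viewed as a section of $M^{\otimes d}$ via the given isomorphism), and $t\in H^0(\overline{M},p^*M)$ the tautological section. Then $Y\subset\overline{M}$ is the divisor of zeros of the section $p^*s_B-t^d$ of $p^*M^{\otimes d}$, and $\pi=p|_Y:Y\to X$. $k$-very ampleness: for an integer $k\ge 0$, a line bundle $L$ on a smooth projective variety $X$ is called $k$-very ample if for every zero-dimensional subscheme $(\mathcal{Z},\mathcal{O}_{\mathcal{Z}})\subset(X,\mathcal{O}_X)$ of length $k+1$ the natural map $H^0(X,L)\to H^0(X,L\otimes\mathcal{O}_{\mathcal{Z}})$ is surjective. Numerical functions: for positive integers $k,\ell$ put $\gamma(k,\ell)=1$ if $k/\ell$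 is an integer and $\gamma(k,\ell)=0$ otherwise, and $$\tau(k,\ell)=k-\left\lfloor\frac{k}{\ell}\right\rfloor-\ell+\gamma(k,\ell)+1.$$ Further put $\sigma(k,d,0)=k$ and, for $q>0$, $$\sigma(k,d,q)=\max\left\{\tau(k+1,\ell)\ \Big|\ \ell\in\mathbb{Z},\ q+1\le\ell\le\min(d,k+1)\right\}-1 .$$ *)

(* Defs.v *)
(* Varieties over C = R[i] (R : realType) are varieties in Serre's sense: spaces
   with functions, locally given by quotients of polynomials.  Closed
   subschemes, possibly non-reduced, are given by their sheaves of ideals, and
   line bundles by transition functions on an open cover. *)
From HB Require Import structures.
From mathcomp Require Import all_boot all_order all_algebra.
From mathcomp Require Import mathcomp_extra boolp classical_sets functions.
From mathcomp Require Import cardinality reals topology.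
From mathcomp Require Import complex.
From mathcomp Require Import mpoly.

Set Implicit Arguments.
Unset Strict Implicit.
Unset Printing Implicit Defensive.
Import Order.TTheory GRing.Theory Num.Theory.
Local Open Scope classical_set_scope.
Local Open Scope ring_scope.
Local Open Scope complex_scope.

(* [regular U] is meant for open [U] only; a function regular on U has type
   X -> C, and its values outside U are irrelevant ([regular_local]). *)
Record funspace (R : realType) := Funspace {
  pt :> topologicalType;
  regular : set pt -> set (pt -> R[i]);
  regular_restrict : forall U V f,
    open V -> V `<=` U -> regular U f -> regular V f;
  regular_local : forall U f, open U ->
    (forall x, U x -> exists V g, [/\ open V, V x, regular V g &
       forall y, U y -> V y -> f y = g y]) -> regular U f;
  regular_cst : forall U c, open U -> regular U (cst c);
  regularD : forall U f g, open U ->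
    regular U f -> regular U g -> regular U (f + g);
  regularM : forall U f g, open U ->
    regular U f -> regular U g -> regular U (f * g);
  regular_neq0_open : forall U f, open U ->
    regular U f -> open (U `&` [set x | f x != 0]);
  regularV : forall U f, open U -> regular U f ->
    (forall x, U x -> f x != 0) -> regular U (fun x => (f x)^-1)
}.
Arguments regular {R X} : rename.

Record morphism (R : realType) (X Y : funspace R) := Morphism {
  mfun :> X -> Y;
  morphism_open : forall U, open U -> open (mfun @^-1` U);
  morphism_regular : forall U f, open U ->
    regular U f -> regular (mfun @^-1` U) (f \o mfun)
}.

Definition isomorphic (R : realType) (X Y : funspace R) :=
  exists (f : morphism X Y) (g : morphism Y X), cancel f g /\ cancel g f.

Program Definition comp_morphism (R : realType) (X Y Z : funspace R)
    (g : morphism Y Z) (f : morphism X Y) : morphism X Z :=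
  @Morphism R X Z (fun x => g (f x)) _ _.
Next Obligation.
by move=> R X Y Z g f U oU; exact: (morphism_open f (morphism_open g oU)).
Qed.
Next Obligation.
move=> R X Y Z g f U h oU rh.
exact: (morphism_regular f (morphism_open g oU) (morphism_regular g oU rh)).
Qed.

Section Subspace.
Context {R : realType} {X : funspace R} (A : set X).

Definition sub_regular (U : set (set_type A)) (f : set_type A -> R[i]) :=
  forall x, U x -> exists V g, [/\ open V, V (set_val x), regular V g &
    forall y, U y -> V (set_val y) -> f y = g (set_val y)].

Program Definition subfunspace : funspace R :=
  @Funspace R (set_type A) sub_regular _ _ _ _ _ _ _.
Next Obligation.
move=> U V f _ VU rf x Vx; have [W [g [oW Wx rg fg]]] := rf x (VU _ Vx).
by exists W, g; split=> // y Vy Wy; apply: fg => //; exact: VU.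
Qed.
Next Obligation.
move=> U f _ H x Ux; have [V [g [oV Vx rg fg]]] := H x Ux.
have [W [h [oW Wx rh gh]]] := rg x Vx.
have [V' oV' V'V] := oV; exists (W `&` V'), h; split.
- exact: openI.
- by split=> //; rewrite -V'V in Vx.
- by apply: (regular_restrict _ _ rh); [exact: openI|exact: subIsetl].
- move=> y Uy [Wy V'y]; have Vy : V y by rewrite -V'V.
  by rewrite fg // gh.
Qed.
Next Obligation.
move=> U c _ x _; exists setT, (cst c); split=> //; first exact: openT.
exact/regular_cst/openT.
Qed.
Next Obligation.
move=> U f g _ rf rg x Ux.
have [V [f' [oV Vx rf' ff']]] := rf x Ux.
have [W [g' [oW Wx rg' gg']]] := rg x Ux.
have oVW : open (V `&` W) by exact: openI.
exists (V `&` W), (f' + g'); split=> //.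
  apply: regularD => //.
    by apply: (regular_restrict oVW _ rf'); exact: subIsetl.
  by apply: (regular_restrict oVW _ rg'); exact: subIsetr.
by move=> y Uy [Vy Wy]; rewrite !fctE ff' // gg'.
Qed.
Next Obligation.
move=> U f g _ rf rg x Ux.
have [V [f' [oV Vx rf' ff']]] := rf x Ux.
have [W [g' [oW Wx rg' gg']]] := rg x Ux.
have oVW : open (V `&` W) by exact: openI.
exists (V `&` W), (f' * g'); split=> //.
  apply: regularM => //.
    by apply: (regular_restrict oVW _ rf'); exact: subIsetl.
  by apply: (regular_restrict oVW _ rg'); exact: subIsetr.
by move=> y Uy [Vy Wy]; rewrite !fctE ff' // gg'.
Qed.
Next Obligation.
move=> U f oU rf; rewrite openE => x [Ux fx0].
have [V [g [oV Vx rg fg]]] := rf x Ux.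
have oW := regular_neq0_open oV rg.
pose N := U `&` (set_val @^-1` (V `&` [set x | g x != 0])).
have oN : open N by apply: openI => //; exists (V `&` [set x | g x != 0]).
rewrite /interior nbhsE; exists N; first split=> //.
  by split=> //; split=> //=; rewrite -fg.
by move=> y [Uy [Vy gy]]; split=> //=; rewrite fg.
Qed.
Next Obligation.
move=> U f oU rf f0 x Ux; have [V [g [oV Vx rg fg]]] := rf x Ux.
have oW := regular_neq0_open oV rg.
exists (V `&` [set x | g x != 0]), (fun x => (g x)^-1); split=> //.
- by split=> //=; rewrite -fg // f0.
- apply: regularV => //; last by move=> y [].
  by apply: (regular_restrict oW _ rg); exact: subIsetl.
- by move=> y Uy [Vy _]; rewrite fg.
Qed.

Program Definition sub_incl : morphism subfunspace X :=
  @Morphism R subfunspace X set_val _ _.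
Next Obligation. by move=> U oU; exists U. Qed.
Next Obligation. by move=> U f oU rf x Ux; exists U, f. Qed.

End Subspace.

Section ProjectiveSpace.
Context (R : realType) (n : nat).
Local Notation C := R[i].
Implicit Types (p q : {mpoly C[n.+1]}).

(* The points of P^n are the lines in C^(n+1). *)
Record proj_pt := ProjPt {
  line :> {vspace 'rV[C]_n.+1};
  dim_line : \dim line = 1%N
}.
HB.instance Definition _ := gen_eqMixin proj_pt.
HB.instance Definition _ := gen_choiceMixin proj_pt.

Definition nonvanishing p : set proj_pt :=
  [set l | exists2 v, v \in line l & p.@[v ord0] != 0].

Definition zariski_open (U : set proj_pt) :=
  forall l, U l -> exists d p,
    [/\ p \is d.-homog, nonvanishing p l & nonvanishing p `<=` U].

Lemma mevalZ_homog d p (c : C) (v : 'rV[C]_n.+1) : p \is d.-homog ->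
  p.@[(c *: v) ord0] = c ^+ d * p.@[v ord0].
Proof.
move=> /dhomogP hp; rewrite !mevalE mulr_sumr; apply: eq_big_seq => m /hp dm.
rewrite mulrCA; congr (_ * _).
transitivity (\prod_i (c ^+ m i * v ord0 i ^+ m i)).
  by apply: eq_bigr => i _; rewrite mxE exprMn.
by rewrite big_split /= -dm /= mdegE expr_sum.
Qed.

Lemma line_gen (l : proj_pt) : exists2 e, e != 0 &
  forall v, v \in line l <-> exists c, v = c *: e.
Proof.
have l0 : (line l : {vspace _}) != 0%VS by rewrite -dimv_eq0 dim_line.
have e0 : vpick l != 0 by rewrite vpick0.
have lE : line l = <[vpick l]>%VS.
  apply/esym/eqP; rewrite eqEdim dim_line dim_vline e0 andbT.
  by rewrite -memvE memv_pick.
exists (vpick l) => // v; rewrite {1}lE.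
by split=> [/vlineP//|[c ->]]; rewrite memvZ ?memv_line.
Qed.

Lemma nonvanishing_gen d p l e : p \is d.-homog -> e != 0 ->
  (forall v, v \in line l <-> exists c, v = c *: e) ->
  nonvanishing p l <-> p.@[e ord0] != 0.
Proof.
move=> hp e0 le; split=> [[_ /le[c ->]]|pe].
  by rewrite (mevalZ_homog _ _ hp); apply: contra_neq => ->; rewrite mulr0.
by exists e => //; apply/le; exists 1; rewrite scale1r.
Qed.

Lemma nonvanishingM d d' p q : p \is d.-homog -> q \is d'.-homog ->
  nonvanishing (p * q) = nonvanishing p `&` nonvanishing q.
Proof.
move=> hp hq; apply/seteqP; split=> l.
  move=> [v lv]; rewrite mevalM mulf_eq0 negb_or => /andP[pv qv].
  by split; exists v.
have [e e0 le] := line_gen l.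
move=> [/(nonvanishing_gen hp e0 le) pe /(nonvanishing_gen hq e0 le) qe].
apply/(nonvanishing_gen (dhomogM hp hq) e0 le).
by rewrite mevalM mulf_neq0.
Qed.

Let openT' : zariski_open setT.
Proof.
move=> l _; exists 0%N, 1; split=> //; first exact: dhomog1.
by exists 0; rewrite ?mem0v // meval1 oner_neq0.
Qed.

Let openI' : setI_closed zariski_open.
Proof.
move=> U V oU oV l [Ul Vl].
have [d [p [hp pl pU]]] := oU l Ul; have [e [q [hq ql qV]]] := oV l Vl.
exists (d + e)%N, (p * q); rewrite (nonvanishingM hp hq).
split=> //; first exact: dhomogM.
by move=> m [pm qm]; split; [exact: pU|exact: qV].
Qed.

Let open_bigU' (I : Type) (f : I -> set proj_pt) :
  (forall i, zariski_open (f i)) -> zariski_open (\bigcup_i f i).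
Proof.
move=> of_ l [i _ fil]; have [d [p [hp pl pf]]] := of_ i l fil.
by exists d, p; split=> // m /pf; exists i.
Qed.

HB.instance Definition _ :=
  isOpenTopological.Build proj_pt openT' openI' open_bigU'.

Lemma proj_openE (U : set proj_pt) : open U = zariski_open U.
Proof. by []. Qed.

Lemma nonvanishing_open d p : p \is d.-homog -> open (nonvanishing p).
Proof. by move=> hp; rewrite proj_openE => l pl; exists d, p; split. Qed.

(* Locally a quotient of two homogeneous polynomials of the same degree. *)
Definition proj_regular (U : set proj_pt) (f : proj_pt -> C) :=
  forall l, U l -> exists W d p q,
    [/\ open W, W l, p \is d.-homog, q \is d.-homog & forall m, W m ->
      nonvanishing q m /\ forall v, v \in line m -> q.@[v ord0] != 0 ->
        f m = p.@[v ord0] / q.@[v ord0]].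

Let proj_restrict U V f :
  open V -> V `<=` U -> proj_regular U f -> proj_regular V f.
Proof. by move=> _ VU rf l /VU /rf. Qed.

Let proj_local U f : open U ->
  (forall x, U x -> exists V g, [/\ open V, V x, proj_regular V g &
     forall y, U y -> V y -> f y = g y]) -> proj_regular U f.
Proof.
move=> oU H l Ul; have [V [g [oV Vl rg fg]]] := H l Ul.
have [W [d [p [q [oW Wl hp hq gE]]]]] := rg l Vl.
exists (U `&` (V `&` W)), d, p, q; split=> //.
  by apply: openI => //; exact: openI.
move=> m [Um [Vm Wm]]; have [qm gm] := gE m Wm; split=> // v mv qv.
by rewrite fg // (gm v).
Qed.

Let proj_cst U c : open U -> proj_regular U (cst c).
Proof.
move=> oU l Ul; exists U, 0%N, (c *: 1), 1; split=> //.
- by apply: rpredZ; exact: dhomog1.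
- exact: dhomog1.
move=> m _; split; first by exists 0; rewrite ?mem0v // meval1 oner_neq0.
by move=> v _ _; rewrite mevalZ meval1 mulr1 divr1.
Qed.

Let proj_add U f g : open U ->
  proj_regular U f -> proj_regular U g -> proj_regular U (f + g).
Proof.
move=> oU rf rg l Ul.
have [W [d [p [q [oW Wl hp hq fE]]]]] := rf l Ul.
have [W' [d' [p' [q' [oW' Wl' hp' hq' gE]]]]] := rg l Ul.
exists (W `&` W'), (d + d')%N, (p * q' + q * p'), (q * q'); split=> //.
- exact: openI.
- by apply: rpredD; exact: dhomogM.
- exact: dhomogM.
move=> m [Wm Wm']; have [qm fm] := fE m Wm; have [qm' gm] := gE m Wm'.
split; first by rewrite (nonvanishingM hq hq').
move=> v mv; rewrite !mevalM mulf_eq0 negb_or => /andP[qv qv'].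
by rewrite fctE (fm v) // (gm v) // mevalD !mevalM addf_div // [_ * q.@[_]]mulrC.
Qed.

Let proj_mul U f g : open U ->
  proj_regular U f -> proj_regular U g -> proj_regular U (f * g).
Proof.
move=> oU rf rg l Ul.
have [W [d [p [q [oW Wl hp hq fE]]]]] := rf l Ul.
have [W' [d' [p' [q' [oW' Wl' hp' hq' gE]]]]] := rg l Ul.
exists (W `&` W'), (d + d')%N, (p * p'), (q * q').
split; [exact: openI|by []|exact: dhomogM|exact: dhomogM|].
move=> m [Wm Wm']; have [qm fm] := fE m Wm; have [qm' gm] := gE m Wm'.
split; first by rewrite (nonvanishingM hq hq').
move=> v mv; rewrite !mevalM mulf_eq0 negb_or => /andP[qv qv'].
by rewrite fctE (fm v) // (gm v) // mulf_div.
Qed.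

Let proj_eq0 f p q l : nonvanishing q l ->
  (forall v, v \in line l -> q.@[v ord0] != 0 ->
     f l = p.@[v ord0] / q.@[v ord0]) ->
  forall d, p \is d.-homog -> q \is d.-homog ->
  f l != 0 <-> nonvanishing p l.
Proof.
move=> ql fl d hp hq; have [e e0 le] := line_gen l.
have qe := (nonvanishing_gen hq e0 le).1 ql.
have ee : e \in line l by apply/le; exists 1; rewrite scale1r.
rewrite (nonvanishing_gen hp e0 le) (fl e) // mulf_eq0 invr_eq0 (negPf qe).
by rewrite orbF.
Qed.

Let proj_neq0_open U f : open U ->
  proj_regular U f -> open (U `&` [set x | f x != 0]).
Proof.
move=> oU rf; rewrite openE => l [Ul fl0].
have [W [d [p [q [oW Wl hp hq fE]]]]] := rf l Ul.
rewrite /interior nbhsE; exists (U `&` (W `&` nonvanishing p)).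
  split; first by do 2?apply: openI => //; exact: nonvanishing_open hp.
  by split=> //; split=> //; have [? ?] := fE l Wl; apply/(proj_eq0 (f := f)); eauto.
move=> m [Um [Wm pm]]; split=> //=; have [? ?] := fE m Wm.
by apply/(proj_eq0 (f := f) (p := p) (q := q)); eauto.
Qed.

Let proj_inv U f : open U -> proj_regular U f ->
  (forall x, U x -> f x != 0) -> proj_regular U (fun x => (f x)^-1).
Proof.
move=> oU rf f0 l Ul; have [W [d [p [q [oW Wl hp hq fE]]]]] := rf l Ul.
exists (U `&` W), d, q, p; split=> //; first exact: openI.
move=> m [Um Wm]; have [qm fm] := fE m Wm.
have pm : nonvanishing p m.
  by apply/(proj_eq0 (f := f) (p := p) (q := q)); eauto.
split=> // v mv pv; have [e e0 le] := line_gen m.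
have qv : q.@[v ord0] != 0.
  have qe := (nonvanishing_gen hq e0 le).1 qm.
  move: mv pv => /le[c ->]; rewrite !(mevalZ_homog _ _ hp, mevalZ_homog _ _ hq).
  by rewrite !mulf_eq0 (negPf qe) orbF => /norP[].
by rewrite (fm v) // invf_div.
Qed.

Definition proj_space : funspace R :=
  @Funspace R proj_pt proj_regular proj_restrict proj_local proj_cst
    proj_add proj_mul proj_neq0_open proj_inv.

End ProjectiveSpace.

Definition irreducible_set (T : topologicalType) (A : set T) :=
  A !=set0 /\ forall F G : set T, closed F -> closed G ->
    A `<=` F `|` G -> A `<=` F \/ A `<=` G.

Definition projective_variety (R : realType) (X : funspace R) :=
  exists n (A : set (proj_space R n)),
    [/\ closed A, irreducible_set A & isomorphic X (subfunspace A)].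

Record ideal_sheaf (R : realType) (X : funspace R) := IdealSheaf {
  ideal :> set X -> set (X -> R[i]);
  ideal_regular : forall U f, open U -> ideal U f -> regular U f;
  ideal_restrict : forall U V f, open U -> open V -> V `<=` U ->
    ideal U f -> ideal V f;
  ideal_local : forall U f, open U ->
    (forall x, U x -> exists V g, [/\ open V, V x, ideal V g &
       forall y, U y -> V y -> f y = g y]) -> ideal U f;
  ideal0 : forall U, open U -> ideal U (cst 0);
  idealD : forall U f g, open U -> ideal U f -> ideal U g -> ideal U (f + g);
  idealM : forall U f g, open U ->
    regular U f -> ideal U g -> ideal U (f * g)
}.

(* The stalk at x of a subsheaf of the sheaf of all functions; a germ is
   represented by any function X -> C inducing it. *)
Definition stalk (R : realType) (X : funspace R)
    (F : set X -> set (X -> R[i])) (x : X) : set (X -> R[i]) :=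
  [set f | exists U, [/\ open U, U x & F U f]].

Definition vanishing (R : realType) (X : funspace R) (J : ideal_sheaf X) :=
  [set x : X | ~ stalk J x (cst 1)].

Program Definition zero_ideal (R : realType) (X : funspace R) : ideal_sheaf X :=
  @IdealSheaf R X (fun U => [set f | forall x, U x -> f x = 0]) _ _ _ _ _ _.
Next Obligation.
move=> R X U f oU f0; apply: regular_local => // x Ux.
exists U, (cst 0); split=> //; first exact: regular_cst.
by move=> y Uy _; rewrite f0.
Qed.
Next Obligation. by move=> R X U V f _ _ VU f0 x /VU /f0. Qed.
Next Obligation.
by move=> R X U f _ H x Ux; have [V [g [_ Vx g0 ->//]]] := H x Ux; exact: g0.
Qed.
Next Obligation. by []. Qed.
Next Obligation.
by move=> R X U f g _ f0 g0 x Ux; rewrite !fctE f0 // g0 // addr0.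
Qed.
Next Obligation. by move=> R X U f g _ _ g0 x Ux; rewrite !fctE g0 // mulr0. Qed.

(* The dimension of A / B is n, for subspaces B of A of V. *)
Definition quotient_dim (K : fieldType) (V : lmodType K) (A B : set V)
    (n : nat) :=
  exists e : 'I_n -> V, (forall i, A (e i)) /\
    forall f, A f -> exists! c : {ffun 'I_n -> K}, B (f - \sum_i c i *: e i).

(* The local dimension at x of a closed set A: the largest n with a chain
   Z_0 < ... < Z_n of irreducible closed sets, x \in Z_0 and Z_n <= A. *)
Definition has_chain (T : topologicalType) (A : set T) (x : T) (n : nat) :=
  exists Z : nat -> set T,
    [/\ forall i, (i <= n)%N -> closed (Z i) /\ irreducible_set (Z i),
        forall i, (i < n)%N -> Z i `<` Z i.+1, Z 0%N x & Z n `<=` A].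

Definition local_dim (T : topologicalType) (A : set T) (x : T) (n : nat) :=
  has_chain A x n /\ ~ has_chain A x n.+1.

Section Regularity.
Context (R : realType) (X : funspace R) (J : ideal_sheaf X).

Definition max_ideal (x : X) : set (X -> R[i]^o) :=
  [set f | stalk regular x f /\ f x = 0].

(* m_x^2 + J_x *)
Definition max_ideal2 (x : X) : set (X -> R[i]^o) :=
  [set f | exists n (a b : 'I_n -> X -> R[i]),
    [/\ forall i, max_ideal x (a i), forall i, max_ideal x (b i) &
        stalk J x (f - \sum_i a i * b i)]].

(* O_{X,x}/J_x is a regular local ring: its cotangent space m/m^2, that is
   m_x/(m_x^2 + J_x), has dimension dim O_{X,x}/J_x. *)
Definition regular_point (x : X) :=
  exists n, local_dim (vanishing J) x n /\
    quotient_dim (max_ideal x) (max_ideal2 x) n.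

End Regularity.

Definition smooth_scheme (R : realType) (X : funspace R) (J : ideal_sheaf X) :=
  forall x, vanishing J x -> regular_point J x.

Definition smooth_projective_variety (R : realType) (X : funspace R) :=
  projective_variety X /\ smooth_scheme (zero_ideal X).

(* Sections over U of the quotient sheaf O_X/J, as compatible families of
   germs; such a family represents 0 when it satisfies [quotient_zero]. *)
Section QuotientSheaf.
Context (R : realType) (X : funspace R) (J : ideal_sheaf X).

Definition quotient_section (U : set X) : set (X -> X -> R[i]^o) :=
  [set s | forall x, U x -> exists V, [/\ open V, V x, V `<=` U,
     regular V (s x) & forall y, V y -> stalk J y (s x - s y)]].

Definition quotient_zero (U : set X) : set (X -> X -> R[i]^o) :=
  [set s | forall x, U x -> stalk J x (s x)].

(* Finite support and finite-dimensional sections force J to be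
   quasi-coherent, so that J is the ideal of a closed subscheme. *)
Definition zero_dim_subscheme (n : nat) :=
  finite_set (vanishing J) /\
  quotient_dim (quotient_section setT) (quotient_zero setT) n.

End QuotientSheaf.

(* On the chart [lb_dom i] a section is a function s_i, with
   s_i = g_ij s_j for the transition functions g_ij. *)
Record line_bundle (R : realType) (X : funspace R) := LineBundle {
  lb_idx : Type;
  lb_dom : lb_idx -> set X;
  lb_trans : lb_idx -> lb_idx -> X -> R[i];
  lb_open : forall i, open (lb_dom i);
  lb_cover : forall x, exists i, lb_dom i x;
  lb_regular : forall i j, regular (lb_dom i `&` lb_dom j) (lb_trans i j);
  lb_neq0 : forall i j x, lb_dom i x -> lb_dom j x -> lb_trans i j x != 0;
  lb_cocycle : forall i j k x, lb_dom i x -> lb_dom j x -> lb_dom k x ->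
    lb_trans i j x * lb_trans j k x = lb_trans i k x
}.

Definition global_section (R : realType) (X : funspace R) (L : line_bundle X)
    (s : lb_idx L -> X -> R[i]) :=
  (forall i, regular (lb_dom i) (s i)) /\
  forall i j x, lb_dom i x -> lb_dom j x -> s i x = lb_trans i j x * s j x.

Arguments global_section {R X} L s.

Definition zero_locus (R : realType) (X : funspace R) (L : line_bundle X)
    (s : lb_idx L -> X -> R[i]) :=
  [set x : X | forall i, lb_dom i x -> s i x = 0].
Arguments zero_locus {R X} L s.

Record line_bundle_iso (R : realType) (X : funspace R) (L L' : line_bundle X) :=
    LineBundleIso {
  iso_fun :> lb_idx L' -> lb_idx L -> X -> R[i];
  iso_regular : forall i j, regular (lb_dom i `&` lb_dom j) (iso_fun i j);
  iso_neq0 : forall i j x, lb_dom i x -> lb_dom j x -> iso_fun i j x != 0;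
  iso_compat : forall i i' j j' x,
    lb_dom i x -> lb_dom i' x -> lb_dom j x -> lb_dom j' x ->
    iso_fun i j x * lb_trans j j' x = lb_trans i i' x * iso_fun i' j' x
}.

Definition iso_maps (R : realType) (X : funspace R) (L L' : line_bundle X)
    (phi : line_bundle_iso L L') (s : lb_idx L -> X -> R[i])
    (s' : lb_idx L' -> X -> R[i]) :=
  forall i j x, lb_dom i x -> lb_dom j x -> s' i x = phi i j x * s j x.

Lemma regularX (R : realType) (X : funspace R) (U : set X) (f : X -> R[i]) n :
  open U -> regular U f -> regular U (fun x => f x ^+ n).
Proof.
move=> oU rf; elim: n => [|n IH]; first exact: (regular_cst 1 oU).
have -> : (fun x => f x ^+ n.+1) = f * (fun x => f x ^+ n).
  by apply/funext => x; rewrite exprS.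
exact: regularM.
Qed.

Program Definition lb_pow (R : realType) (X : funspace R) (L : line_bundle X)
    (n : nat) : line_bundle X :=
  @LineBundle R X (lb_idx L) (@lb_dom R X L)
    (fun i j x => lb_trans i j x ^+ n) _ _ _ _ _.
Next Obligation. by move=> R X L n i; exact: lb_open. Qed.
Next Obligation. by move=> R X L n x; exact: lb_cover. Qed.
Next Obligation.
move=> R X L n i j; apply: regularX; last exact: lb_regular.
by apply: openI; exact: lb_open.
Qed.
Next Obligation. by move=> R X L n i j x xi xj; rewrite expf_neq0 ?lb_neq0. Qed.
Next Obligation.
by move=> R X L n i j k x xi xj xk; rewrite -exprMn lb_cocycle.
Qed.

Program Definition lb_dual (R : realType) (X : funspace R) (L : line_bundle X)
    : line_bundle X :=
  @LineBundle R X (lb_idx L) (@lb_dom R X L)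
    (fun i j x => (lb_trans i j x)^-1) _ _ _ _ _.
Next Obligation. by move=> R X L i; exact: lb_open. Qed.
Next Obligation. by move=> R X L x; exact: lb_cover. Qed.
Next Obligation.
move=> R X L i j; apply: regularV; last by move=> x [xi xj]; exact: lb_neq0.
  by apply: openI; exact: lb_open.
exact: lb_regular.
Qed.
Next Obligation. by move=> R X L i j x xi xj; rewrite invr_eq0 lb_neq0. Qed.
Next Obligation.
by move=> R X L i j k x xi xj xk; rewrite -invfM lb_cocycle.
Qed.

Program Definition lb_tensor (R : realType) (X : funspace R)
    (L L' : line_bundle X) : line_bundle X :=
  @LineBundle R X (lb_idx L * lb_idx L')%type
    (fun i => lb_dom i.1 `&` lb_dom i.2)
    (fun i j => lb_trans i.1 j.1 * lb_trans i.2 j.2) _ _ _ _ _.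
Next Obligation. by move=> R X L L' i; apply: openI; exact: lb_open. Qed.
Next Obligation.
move=> R X L L' x; have [i xi] := lb_cover L x; have [j xj] := lb_cover L' x.
by exists (i, j).
Qed.
Next Obligation.
move=> R X L L' i j.
have o : open (lb_dom i.1 `&` lb_dom i.2 `&` (lb_dom j.1 `&` lb_dom j.2)).
  by do 2?apply: openI; exact: lb_open.
apply: regularM => //.
  by apply: (regular_restrict o _ (lb_regular _ _)) => x [[? ?] [? ?]].
by apply: (regular_restrict o _ (lb_regular _ _)) => x [[? ?] [? ?]].
Qed.
Next Obligation.
by move=> R X L L' i j x [? ?] [? ?]; rewrite fctE mulf_neq0 ?lb_neq0.
Qed.
Next Obligation.
by move=> R X L L' i j k x [? ?] [? ?] [? ?]; rewrite !fctE mulrACA !lb_cocycle.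
Qed.

Program Definition lb_pullback (R : realType) (X Y : funspace R)
    (f : morphism Y X) (L : line_bundle X) : line_bundle Y :=
  @LineBundle R Y (lb_idx L) (fun i => f @^-1` lb_dom i)
    (fun i j => lb_trans i j \o f) _ _ _ _ _.
Next Obligation.
by move=> R X Y f L i; apply: morphism_open; exact: lb_open.
Qed.
Next Obligation. by move=> R X Y f L x; exact: lb_cover. Qed.
Next Obligation.
move=> R X Y f L i j.
apply: (morphism_regular f _ (lb_regular i j)).
by apply: openI; exact: lb_open.
Qed.
Next Obligation. by move=> R X Y f L i j x; exact: lb_neq0. Qed.
Next Obligation. by move=> R X Y f L i j k x; exact: lb_cocycle. Qed.

(* Surjectivity of H^0(X, L) -> H^0(X, L (x) O_Z): a section of L (x) O_Z is a
   family of sections t_i of O_Z over the charts with t_i = g_ij t_j. *)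
Definition twisted_section (R : realType) (X : funspace R) (L : line_bundle X)
    (J : ideal_sheaf X) (t : lb_idx L -> X -> X -> R[i]) :=
  (forall i, quotient_section J (lb_dom i) (t i)) /\
  forall i j x, lb_dom i x -> lb_dom j x ->
    stalk J x (t i x - lb_trans i j * t j x).

Arguments twisted_section {R X} L J t.

Definition k_very_ample (R : realType) (X : funspace R) (L : line_bundle X)
    (k : int) :=
  forall (J : ideal_sheaf X) (n : nat), n%:Z = k + 1 ->
    zero_dim_subscheme J n -> forall t, twisted_section L J t ->
    exists2 s, global_section L s &
      forall i x, lb_dom i x -> stalk J x (s i - t i x).

Record divisor (R : realType) (X : funspace R) := Divisor {
  div_idx : Type;
  div_dom : div_idx -> set X;
  div_eqn : div_idx -> X -> R[i];
  div_unit : div_idx -> div_idx -> X -> R[i];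
  div_open : forall i, open (div_dom i);
  div_cover : forall x, exists i, div_dom i x;
  div_eqn_regular : forall i, regular (div_dom i) (div_eqn i);
  div_nonzerodivisor : forall i U g, open U -> U `<=` div_dom i ->
    regular U g -> (forall x, U x -> g x * div_eqn i x = 0) ->
    forall x, U x -> g x = 0;
  div_unit_regular : forall i j,
    regular (div_dom i `&` div_dom j) (div_unit i j);
  div_unitE : forall i j x, div_dom i x -> div_dom j x ->
    div_eqn i x = div_unit i j x * div_eqn j x
}.

Section Divisor.
Context (R : realType) (X : funspace R) (B : divisor X).

Let div_unit_cocycle (i j k : div_idx B) x :
  div_dom i x -> div_dom j x -> div_dom k x ->
  div_unit i j x * div_unit j k x = div_unit i k x.
Proof.
move=> xi xj xk.
have oi := @div_open R X B i; have oj := @div_open R X B j.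
have ok := @div_open R X B k.
pose U := div_dom i `&` (div_dom j `&` div_dom k).
have oU : open U by do 2?apply: openI.
pose g := div_unit i j * div_unit j k + cst (-1) * div_unit i k.
have := @div_nonzerodivisor R X B k U g oU.
suff H : regular U g /\ forall x, U x -> g x * div_eqn k x = 0.
  move=> /(_ (fun x Ux => Ux.2.2) H.1 H.2 x (conj xi (conj xj xk))).
  by rewrite /g !fctE mulN1r => /eqP; rewrite subr_eq0 => /eqP.
split.
  apply: regularD => //; apply: regularM => //; last 1 first.
  - by apply: (regular_restrict oU _ (div_unit_regular _ _)) => y [? [? ?]].
  - by apply: (regular_restrict oU _ (div_unit_regular _ _)) => y [? [? ?]].
  - by apply: (regular_restrict oU _ (div_unit_regular _ _)) => y [? [? ?]].
  - exact: regular_cst.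
move=> y [yi [yj yk]].
rewrite /g !fctE mulN1r mulrBl -mulrA -!div_unitE //.
by rewrite subrr.
Qed.

Let div_unit_neq0 (i j : div_idx B) x :
  div_dom i x -> div_dom j x -> div_unit i j x != 0.
Proof.
move=> xi xj.
have oi := @div_open R X B i.
suff uii : div_unit i i x = 1 :> R[i].
  have := div_unit_cocycle xi xj xi; rewrite uii => u1.
  by apply/negP => /eqP u0; move: u1; rewrite u0 mul0r => /esym/eqP; rewrite oner_eq0.
pose g := div_unit i i + cst (-1).
have := @div_nonzerodivisor R X B i (div_dom i) g oi.
suff H : regular (div_dom i) g /\ forall x, div_dom i x -> g x * div_eqn i x = 0.
  move=> /(_ (fun x Ux => Ux) H.1 H.2 x xi).
  by rewrite /g !fctE => /eqP; rewrite subr_eq0 => /eqP.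
split.
  apply: regularD => //; last exact: regular_cst.
  by apply: (regular_restrict oi _ (div_unit_regular _ _)) => y.
by move=> y yi; rewrite /g !fctE mulrBl mul1r -div_unitE // subrr.
Qed.

(* O_X(B), with the canonical section given by the equations of B *)
Definition lb_divisor : line_bundle X :=
  @LineBundle R X (div_idx B) (@div_dom R X B) (@div_unit R X B)
    (@div_open R X B) (@div_cover R X B) (@div_unit_regular R X B)
    div_unit_neq0 div_unit_cocycle.

Program Definition divisor_ideal : ideal_sheaf X :=
  @IdealSheaf R X (fun U => [set f | regular U f /\
    forall x (i : div_idx B), U x -> div_dom i x -> exists V h,
      [/\ open V, V x, regular V h &
          forall y, U y -> V y -> f y = h y * div_eqn i y]]) _ _ _ _ _ _.
Next Obligation. by move=> U f _ []. Qed.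
Next Obligation.
move=> U V f _ oV VU [rf H]; split; first exact: regular_restrict rf.
move=> x i Vx xi; have [W [h [oW Wx rh fE]]] := H x i (VU _ Vx) xi.
by exists W, h; split=> // y /VU Uy Wy; exact: fE.
Qed.
Next Obligation.
move=> U f oU H; split.
  apply: regular_local => // x Ux.
  by have [V [g [oV Vx [rg _] fg]]] := H x Ux; exists V, g.
move=> x i Ux xi; have [V [g [oV Vx [_ Hg] fg]]] := H x Ux.
have [W [h [oW Wx rh gE]]] := Hg x i Vx xi.
exists (V `&` W), h; split=> //; first exact: openI.
  by apply: (regular_restrict _ _ rh); [exact: openI|exact: subIsetr].
by move=> y Uy [Vy Wy]; rewrite fg // gE.
Qed.
Next Obligation.
move=> U oU; split; first exact: regular_cst.
move=> x i Ux xi; exists U, (cst 0); split=> //; first exact: regular_cst.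
by move=> y _ _; rewrite mul0r.
Qed.
Next Obligation.
move=> U f g oU [rf Hf] [rg Hg]; split; first exact: regularD.
move=> x i Ux xi; have [V [h [oV Vx rh fE]]] := Hf x i Ux xi.
have [W [k [oW Wx rk gE]]] := Hg x i Ux xi.
have oVW : open (V `&` W) by exact: openI.
exists (V `&` W), (h + k); split=> //.
  apply: regularD => //.
    by apply: (regular_restrict _ _ rh) => //; exact: subIsetl.
  by apply: (regular_restrict _ _ rk) => //; exact: subIsetr.
by move=> y Uy [Vy Wy]; rewrite !fctE fE // gE // mulrDl.
Qed.
Next Obligation.
move=> U f g oU rf [rg Hg]; split; first exact: regularM.
move=> x i Ux xi; have [V [h [oV Vx rh gE]]] := Hg x i Ux xi.
have oUV : open (U `&` V) by exact: openI.
exists (U `&` V), (f * h); split=> //.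
  apply: regularM => //.
    by apply: (regular_restrict _ _ rf) => //; exact: subIsetl.
  by apply: (regular_restrict _ _ rh) => //; exact: subIsetr.
by move=> y Uy [_ Vy]; rewrite !fctE gE // mulrA.
Qed.

Definition smooth_divisor := smooth_scheme divisor_ideal.

(* Locally s is a unit times the equation of B. *)
Definition divisor_of_zeros (L : line_bundle X) (s : lb_idx L -> X -> R[i]) :=
  forall (i : lb_idx L) (j : div_idx B), exists u,
    [/\ regular (lb_dom i `&` div_dom j) u,
        forall x, lb_dom i x -> div_dom j x -> u x != 0 &
        forall x, lb_dom i x -> div_dom j x -> s i x = u x * div_eqn j x].

End Divisor.
Arguments divisor_of_zeros {R X} B L s.

Section TotalSpace.
Context (R : realType) (X : funspace R) (M : line_bundle X).
Local Notation C := R[i].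

(* The point with base point x and coordinate v_i in the chart i, for each
   chart i containing x; [tp_junk] makes the representation unique. *)
Record total_pt := TotalPt {
  tp_base : X;
  tp_coord : lb_idx M -> C;
  tp_trans : forall i j, lb_dom i tp_base -> lb_dom j tp_base ->
    tp_coord i = lb_trans i j tp_base * tp_coord j;
  tp_junk : forall i, ~ lb_dom i tp_base -> tp_coord i = 0
}.
HB.instance Definition _ := gen_eqMixin total_pt.
HB.instance Definition _ := gen_choiceMixin total_pt.

(* F is polynomial in the fibre coordinate, with coefficients in O(N). *)
Definition chart_poly (i : lb_idx M) (N : set X) (F : total_pt -> C) :=
  exists n (P : X -> {poly C}),
    [/\ forall x, (size (P x) <= n)%N,
        forall k, regular N (fun x => (P x)`_k) &
        forall y, N (tp_base y) -> F y = (P (tp_base y)).[tp_coord y i]].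

Definition fibre_poly (N : set X) (F : total_pt -> C) :=
  exists i, [/\ open N, N `<=` lb_dom i & chart_poly i N F].

Lemma regular_sum (N : set X) n (f : 'I_n -> X -> C) : open N ->
  (forall k, regular N (f k)) -> regular N (fun x => \sum_k f k x).
Proof.
move=> oN; elim: n f => [|n IH] f rf.
  have -> : (fun x => \sum_k f k x) = cst 0.
    by apply/funext => x; rewrite big_ord0.
  exact: regular_cst.
have -> : (fun x => \sum_k f k x) = f ord0 + (fun x => \sum_k f (lift ord0 k) x).
  by apply/funext => x; rewrite big_ord_recl.
by apply: regularD => //; exact: IH.
Qed.

Lemma chart_poly_change i j N F : open N -> N `<=` lb_dom i ->
  N `<=` lb_dom j -> chart_poly i N F -> chart_poly j N F.
Proof.
move=> oN Ni Nj [n [P [sP rP FE]]].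
exists n, (fun x => \poly_(k < n) ((P x)`_k * lb_trans i j x ^+ k)); split.
- by move=> x; exact: size_poly.
- move=> k; case: (ltnP k n) => kn.
    have -> : (fun x => (\poly_(k < n) ((P x)`_k * lb_trans i j x ^+ k))`_k) =
        (fun x => (P x)`_k) * (fun x => lb_trans i j x ^+ k).
      by apply/funext => x; rewrite coef_poly kn.
    apply: regularM => //; apply: regularX => //.
    by apply: (regular_restrict oN _ (lb_regular _ _)) => x Nx; split; [exact: Ni|exact: Nj].
  have -> : (fun x => (\poly_(k < n) ((P x)`_k * lb_trans i j x ^+ k))`_k) = cst 0.
    by apply/funext => x; rewrite coef_poly ltnNge kn.
  exact: regular_cst.
move=> y Ny; rewrite FE // horner_poly (horner_coef_wide _ (sP _)).
apply: eq_bigr => k _; rewrite (tp_trans (Ni _ Ny) (Nj _ Ny)) exprMn.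
by rewrite mulrA.
Qed.

Lemma fibre_poly_restrict N N' F : open N' -> N' `<=` N ->
  fibre_poly N F -> fibre_poly N' F.
Proof.
move=> oN' N'N [i [oN Ni [n [P [sP rP FE]]]]].
exists i; split=> //; first by move=> x /N'N /Ni.
exists n, P; split=> //; last by move=> y /N'N; exact: FE.
by move=> k; exact: (regular_restrict oN' N'N).
Qed.

Lemma fibre_poly_pull (i : lb_idx M) N f : open N -> N `<=` lb_dom i -> regular N f ->
  fibre_poly N (f \o tp_base).
Proof.
move=> oN Ni rf; exists i; split=> //; exists 1%N, (fun x => (f x)%:P); split.
- by move=> x; exact: size_polyC_leq1.
- case=> [|k].
    have -> : (fun x => ((f x)%:P)`_0) = f by apply/funext => x; rewrite coefC.
    by [].
  have -> : (fun x => ((f x)%:P)`_k.+1) = cst 0.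
    by apply/funext => x; rewrite coefC.
  exact: regular_cst.
by move=> y _; rewrite hornerC.
Qed.

Lemma fibre_polyD N F G :
  fibre_poly N F -> fibre_poly N G -> fibre_poly N (F + G).
Proof.
move=> [i [oN Ni [n [P [sP rP FE]]]]] [j [_ Nj Gj]].
have [m [Q [sQ rQ GE]]] := chart_poly_change oN Nj Ni Gj.
exists i; split=> //; exists (maxn n m), (fun x => P x + Q x); split.
- move=> x; rewrite (leq_trans (size_polyD _ _)) // geq_max !leq_max sP sQ.
  by rewrite orbT.
- move=> k; have -> : (fun x => (P x + Q x)`_k) =
    (fun x => (P x)`_k) + (fun x => (Q x)`_k).
    by apply/funext => x; rewrite coefD.
  exact: regularD.
by move=> y Ny; rewrite hornerD fctE FE // GE.
Qed.

Lemma fibre_polyM N F G :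
  fibre_poly N F -> fibre_poly N G -> fibre_poly N (F * G).
Proof.
move=> [i [oN Ni [n [P [sP rP FE]]]]] [j [_ Nj Gj]].
have [m [Q [sQ rQ GE]]] := chart_poly_change oN Nj Ni Gj.
exists i; split=> //; exists (n + m)%N, (fun x => P x * Q x); split.
- move=> x; rewrite (leq_trans (size_polyMleq _ _)) //.
  by rewrite (leq_trans (leq_pred _)) // leq_add.
- move=> k; have -> : (fun x => (P x * Q x)`_k) =
    (fun x => \sum_(l < k.+1) ((fun x => (P x)`_l) * (fun x => (Q x)`_(k - l))) x).
    by apply/funext => x; rewrite coefM.
  by apply: regular_sum => // l; exact: regularM.
by move=> y Ny; rewrite hornerM fctE FE // GE.
Qed.

(* The topology of N x A^1 has the sets F != 0 as a basis. *)
Definition total_open (U : set total_pt) := forall y, U y -> exists N F,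
  [/\ fibre_poly N F, N (tp_base y), F y != 0 &
      forall z, N (tp_base z) -> F z != 0 -> U z].

Lemma fibre_cst x c : exists2 N, fibre_poly N (cst c) & N x.
Proof.
have [i xi] := lb_cover M x; exists (lb_dom i) => //.
apply: (@fibre_poly_pull i _ (cst c)) => //; first exact: lb_open.
exact/regular_cst/lb_open.
Qed.

Let topT : total_open setT.
Proof.
move=> y _; have [N fN Ny] := fibre_cst (tp_base y) 1.
by exists N, (cst 1); split=> //; rewrite oner_neq0.
Qed.

Let topI : setI_closed total_open.
Proof.
move=> U V oU oV y [Uy Vy].
have [N [F [fF Ny Fy FU]]] := oU y Uy; have [K [G [fG Ky Gy GV]]] := oV y Vy.
have [i [oN _ _]] := fF; have [j [oK _ _]] := fG.
have oNK : open (N `&` K) by exact: openI.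
exists (N `&` K), (F * G); split=> //.
- apply: fibre_polyM.
    by apply: fibre_poly_restrict fF => //; exact: subIsetl.
  by apply: fibre_poly_restrict fG => //; exact: subIsetr.
- by rewrite fctE mulf_neq0.
by move=> z [Nz Kz]; rewrite fctE mulf_eq0 => /norP[Fz Gz]; split; [exact: FU|exact: GV].
Qed.

Let top_bigU (I : Type) (f : I -> set total_pt) :
  (forall i, total_open (f i)) -> total_open (\bigcup_i f i).
Proof.
move=> of_ y [i _ fiy]; have [N [F [fF Ny Fy FU]]] := of_ i y fiy.
by exists N, F; split=> // z Nz Fz; exists i => //; exact: FU.
Qed.

HB.instance Definition _ := isOpenTopological.Build total_pt topT topI top_bigU.

Lemma total_openE (U : set total_pt) : open U = total_open U.
Proof. by []. Qed.

Lemma fibre_poly_open N F : fibre_poly N F ->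
  open [set y | N (tp_base y) /\ F y != 0].
Proof. by move=> fF; rewrite total_openE => y [Ny Fy]; exists N, F; split. Qed.

Lemma tp_base_open (U : set X) : open U -> open (tp_base @^-1` U).
Proof.
move=> oU; rewrite total_openE => y Uy; have [N fN Ny] := fibre_cst (tp_base y) 1.
have [i [oN _ _]] := fN.
exists (U `&` N), (cst 1); split=> //; last by move=> z [].
- by apply: fibre_poly_restrict fN; [exact: openI|exact: subIsetr].
- by rewrite oner_neq0.
Qed.

Definition total_regular (U : set total_pt) (f : total_pt -> C) :=
  forall y, U y -> exists W N F G,
    [/\ open W, W y, fibre_poly N F, fibre_poly N G & forall z, W z ->
      [/\ N (tp_base z), G z != 0 & f z = F z / G z]].

Let tot_restrict U V f :
  open V -> V `<=` U -> total_regular U f -> total_regular V f.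
Proof. by move=> _ VU rf y /VU /rf. Qed.

Let tot_local U f : open U ->
  (forall x, U x -> exists V g, [/\ open V, V x, total_regular V g &
     forall y, U y -> V y -> f y = g y]) -> total_regular U f.
Proof.
move=> oU H y Uy; have [V [g [oV Vy rg fg]]] := H y Uy.
have [W [N [F [G [oW Wy fF fG gE]]]]] := rg y Vy.
exists (U `&` (V `&` W)), N, F, G; split=> //.
  by apply: openI => //; exact: openI.
by move=> z [Uz [Vz Wz]]; have [? ? gz] := gE z Wz; split=> //; rewrite fg.
Qed.

Let tot_cst U c : open U -> total_regular U (cst c).
Proof.
move=> oU y Uy; have [N fc Ny] := fibre_cst (tp_base y) c.
have [N' f1 Ny'] := fibre_cst (tp_base y) 1.
have [i [oN _ _]] := fc; have [j [oN' _ _]] := f1.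
have oNN : open (N `&` N') by exact: openI.
exists (tp_base @^-1` (N `&` N')), (N `&` N'), (cst c), (cst 1); split=> //.
- exact: tp_base_open.
- by apply: fibre_poly_restrict fc => //; exact: subIsetl.
- by apply: fibre_poly_restrict f1 => //; exact: subIsetr.
by move=> z Nz; split=> //; rewrite ?oner_neq0 ?divr1.
Qed.

Let tot_common U f g : total_regular U f -> total_regular U g ->
  forall y, U y -> exists W N F G F' G',
    [/\ open W, W y, [/\ fibre_poly N F, fibre_poly N G, fibre_poly N F' &
      fibre_poly N G'] & forall z, W z ->
      [/\ N (tp_base z), G z != 0, G' z != 0, f z = F z / G z &
          g z = F' z / G' z]].
Proof.
move=> rf rg y Uy.
have [W [N [F [G [oW Wy fF fG fE]]]]] := rf y Uy.
have [W' [N' [F' [G' [oW' Wy' fF' fG' gE]]]]] := rg y Uy.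
have [i [oN _ _]] := fF; have [j [oN' _ _]] := fF'.
have oNN : open (N `&` N') by exact: openI.
exists (W `&` W'), (N `&` N'), F, G, F', G'; split=> //.
- exact: openI.
- split.
  + by apply: fibre_poly_restrict fF => //; exact: subIsetl.
  + by apply: fibre_poly_restrict fG => //; exact: subIsetl.
  + by apply: fibre_poly_restrict fF' => //; exact: subIsetr.
  + by apply: fibre_poly_restrict fG' => //; exact: subIsetr.
move=> z [Wz Wz']; have [? ? ?] := fE z Wz; have [? ? ?] := gE z Wz'.
by split.
Qed.

Let tot_add U f g : open U ->
  total_regular U f -> total_regular U g -> total_regular U (f + g).
Proof.
move=> oU rf rg y Uy.
have [W [N [F [G [F' [G' [oW Wy [fF fG fF' fG'] E]]]]]]] := tot_common rf rg Uy.
exists W, N, (F * G' + F' * G), (G * G'); split=> //.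
- by apply: fibre_polyD; exact: fibre_polyM.
- exact: fibre_polyM.
move=> z /E[Nz Gz Gz' fz gz]; split=> //; first by rewrite fctE mulf_neq0.
by rewrite !fctE fz gz addf_div.
Qed.

Let tot_mul U f g : open U ->
  total_regular U f -> total_regular U g -> total_regular U (f * g).
Proof.
move=> oU rf rg y Uy.
have [W [N [F [G [F' [G' [oW Wy [fF fG fF' fG'] E]]]]]]] := tot_common rf rg Uy.
exists W, N, (F * F'), (G * G'); split=> //; try exact: fibre_polyM.
move=> z /E[Nz Gz Gz' fz gz]; split=> //; first by rewrite fctE mulf_neq0.
by rewrite !fctE fz gz mulf_div.
Qed.

Let tot_neq0_open U f : open U ->
  total_regular U f -> open (U `&` [set x | f x != 0]).
Proof.
move=> oU rf; rewrite openE => y [Uy fy].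
have [W [N [F [G [oW Wy fF fG E]]]]] := rf y Uy.
have fF0 z : W z -> (f z != 0) = (F z != 0).
  by move=> /E[_ Gz ->]; rewrite mulf_eq0 invr_eq0 (negPf Gz) orbF.
rewrite /interior nbhsE; exists (U `&` (W `&` [set z | N (tp_base z) /\ F z != 0])).
  split; first by do 2?apply: openI => //; exact: fibre_poly_open.
  by split=> //; split=> //; have [? ? ?] := E y Wy; split=> //; rewrite -fF0.
by move=> z [Uz [Wz [_ Fz]]]; split=> //=; rewrite fF0.
Qed.

Let tot_inv U f : open U -> total_regular U f ->
  (forall x, U x -> f x != 0) -> total_regular U (fun x => (f x)^-1).
Proof.
move=> oU rf f0 y Uy; have [W [N [F [G [oW Wy fF fG E]]]]] := rf y Uy.
exists (U `&` W), N, G, F; split=> //; first exact: openI.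
move=> z [Uz Wz]; have [Nz Gz fz] := E z Wz; split=> //; last by rewrite fz invf_div.
by have := f0 z Uz; rewrite fz mulf_eq0 => /norP[].
Qed.

Definition total_space : funspace R :=
  @Funspace R total_pt total_regular tot_restrict tot_local tot_cst
    tot_add tot_mul tot_neq0_open tot_inv.

Lemma fibre_poly_regular N F : fibre_poly N F ->
  total_regular (tp_base @^-1` N) F.
Proof.
move=> fF y Ny; have [i [oN Ni _]] := fF.
exists (tp_base @^-1` N), N, F, (cst 1); split=> //.
- exact: tp_base_open.
- exact: (fibre_poly_pull oN Ni (regular_cst 1 oN)).
by move=> z Nz; split=> //; rewrite ?oner_neq0 ?divr1.
Qed.

Program Definition total_proj : morphism total_space X :=
  @Morphism R total_space X tp_base _ _.
Next Obligation. by move=> U; exact: tp_base_open. Qed.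
Next Obligation.
move=> U f oU rf y Uy; have [i yi] := lb_cover M (tp_base y).
have oN : open (U `&` lb_dom i) by apply: openI => //; exact: lb_open.
apply: (@fibre_poly_regular (U `&` lb_dom i)) => //.
have rf' : regular (U `&` lb_dom i) f.
  by apply: (regular_restrict oN _ rf); exact: subIsetl.
exact: (fibre_poly_pull oN (@subIsetr _ _ _) rf').
Qed.

(* The tautological section t of p^*M *)
Definition tautological (i : lb_idx M) (y : total_space) : C := tp_coord y i.

Lemma tautological_section :
  global_section (lb_pullback total_proj M) tautological.
Proof.
split=> [i|i j y yi yj]; last exact: tp_trans.
apply: fibre_poly_regular; exists i; split=> //; first exact: lb_open.
exists 2%N, (fun=> 'X); split=> [x|k|y _]; first by rewrite size_polyX.
  exact/regular_cst/lb_open.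
by rewrite hornerX.
Qed.

End TotalSpace.

Section CyclicCovering.
Context (R : realType) (X : funspace R) (M : line_bundle X) (d : nat).
Context (s : lb_idx (lb_pow M d) -> X -> R[i]).

(* The zeros of the section p^*s - t^d of p^*M^d in the total space of M.
   When s has a smooth divisor of zeros, this section vanishes to order 1
   along them, so its divisor of zeros is this reduced subvariety. *)
Definition cyclic_locus : set (total_space M) :=
  zero_locus (lb_pullback (total_proj M) (lb_pow M d))
    (fun (i : lb_idx M) y => s i (total_proj M y) - tautological i y ^+ d).

Definition cyclic_cover : funspace R := subfunspace cyclic_locus.

Definition cyclic_proj : morphism cyclic_cover X :=
  comp_morphism (total_proj M) (sub_incl cyclic_locus).

End CyclicCovering.

Definition gamma (k l : nat) : nat := (l %| k)%N.

Definition tau (k l : nat) : int :=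
  k%:Z - (k %/ l)%N%:Z - l%:Z + (gamma k l)%:Z + 1.

(* For q > 0 and q + 1 <= min(d, k+1) the range of l starts at q + 1, so the
   default value of the maximum is one of the values. *)
Definition sigma (k d q : nat) : int :=
  if q == 0%N then k%:Z else
  (\big[Order.max/tau k.+1 q.+1]_(q.+1 <= l < (minn d k.+1).+1) tau k.+1 l) - 1.

(* Main.v *)
(* Let t be the fibre coordinate of Y, so that t^d is pulled back from X.  For a
   zero-dimensional subscheme Z of Y of length k + 1, the algebra O_Z is spanned
   by 1, t, ..., t^(d-1) over O_X, and O_X + O_X t + ... + O_X t^q modulo
   O_X + ... + O_X t^(q-1) is O_X/I_q for an ideal I_q of finite colength l_q.
   As I_0, I_1, ... increase, the products a t^j for j <= q and a in a family
   independent modulo I_q are independent in O_Z, whence (q + 1) l_q <= k + 1.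
   This gives l_q <= sigma(k, d, q) + 1 for q <= k, and l_q = 0 for q > k.
   Enlarging the scheme of I_q by reduced points (if X is a point, all is clear),
   sections of L - qM surject onto (L - qM) (x) O_X/I_q; a section of
   pi^*L (x) O_Z is then lifted by killing its coefficients of t^(d-1), ..., t, 1
   in turn with sections u t^q, u in H^0(L - qM).
     Since Z has finite support, a section of O_Z is an arbitrary family of germs
   at the points of Y, modulo the ideal of Z. *)
Require Import Defs.
From mathcomp Require Import all_boot all_order all_algebra.
From mathcomp Require Import boolp classical_sets functions cardinality.
From mathcomp Require Import reals topology complex.
From mathcomp Require Import mpoly ring zify.
Import Order.TTheory GRing.Theory.
Local Open Scope ring_scope.
Local Open Scope complex_scope.
Local Open Scope classical_set_scope.

Set Implicit Arguments.
Unset Strict Implicit.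

(** * Dimensions of quotients *)

(** The coordinates of the [f i] modulo [B] form a matrix with more rows than columns, and a nonzero
    vector of its left kernel is the relation. *)
Lemma quotient_dim_dependent (K : fieldType) (V : lmodType K) (A B : set V)
    n (I : finType) (f : I -> V) :
  B 0 -> (forall u v, B u -> B v -> B (u + v)) ->
  (forall a u, B u -> B (a *: u)) ->
  quotient_dim A B n -> (forall i, A (f i)) -> (n < #|I|)%N ->
  exists c : I -> K, (exists i, c i != 0) /\ B (\sum_i c i *: f i).
Proof.
move=> B0 BD BZ [e [Ae eE]] Af nI.
have /choice[m mE] i : exists c : {ffun 'I_n -> K}, B (f i - \sum_j c j *: e j).
  by have [c [Bc _]] := eE _ (Af i); exists c.
pose M := \matrix_(i < #|I|, j < n) m (enum_val i) j.
have : kermx M != 0.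
  rewrite kermx_eq0 /row_free; apply: contraL nI => /eqP <-.
  by rewrite -leqNgt rank_leq_col.
move=> /rowV0Pn[v /sub_kermxP vM v0].
exists (fun i => v 0 (enum_rank i)); split.
  have /rV0Pn[i vi] := v0.
  by exists (enum_val i); rewrite enum_valK.
(* Since [v *m M = 0], subtracting the combinations of the [e j] leaves the sum unchanged, and each
   term then lies in [B]. *)
rewrite (_ : \sum_i _ =
  \sum_i v 0 (enum_rank i) *: (f i - \sum_j m i j *: e j)).
  by apply: (big_ind B) => // i _; exact/BZ/mE.
apply/esym; under eq_bigr do rewrite scalerBr scaler_sumr.
rewrite sumrB exchange_big /= [X in _ - X]big1 ?subr0 // => j _.
under eq_bigr do rewrite scalerA.
rewrite -scaler_suml (_ : \sum_i _ = (v *m M) 0 j).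
  by rewrite vM mxE scale0r.
rewrite mxE (reindex _ (onW_bij _ (@enum_val_bij I))) /=.
by apply: eq_bigr => i _; rewrite !mxE enum_valK.
Qed.

(** A family in [A] of maximal size among those independent modulo [B] is a basis of the quotient,
    so a bound on independent families bounds the dimension. *)
Lemma quotient_dim_exists (K : fieldType) (V : lmodType K) (A B : set V) N :
  B 0 -> (forall u v, B u -> B v -> B (u + v)) ->
  (forall a u, B u -> B (a *: u)) ->
  (forall m (f : 'I_m -> V), (forall i, A (f i)) ->
     (forall c, B (\sum_i c i *: f i) -> forall i, c i = 0) -> (m <= N)%N) ->
  exists2 m, (m <= N)%N & quotient_dim A B m.
Proof.
move=> B0 BD BZ bnd.
pose indep m := exists f : 'I_m -> V, (forall i, A (f i)) /\
  forall c, B (\sum_i c i *: f i) -> forall i, c i = 0.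
have ex0 : exists m, `[<indep m>].
  by exists 0%N; apply/asboolP; exists (fun=> 0); split=> [[]|c _ []].
have ubN m : `[<indep m>] -> (m <= N)%N by move=> /asboolP[f [Af /bnd->]].
have [m /asboolP[f [Af fi]] maxm] := ex_maxnP ex0 ubN.
exists m; first by apply: ubN; apply/asboolP; exists f.
exists f; split=> // g Ag.
have [c Bc] : exists c : 'I_m -> K, B (g - \sum_i c i *: f i).
  (* Otherwise [g] put in front of [f] gives a longer independent family: a relation with nonzero
     coefficient at [g] could be solved for [g]. *)
  apply: contrapT => nB; have : (m.+1 <= m)%N; last by rewrite ltnn.
  apply/maxm/asboolP.
  exists (fun i => if unlift ord0 i is Some j then f j else g); split=> [i|c].
    by case: unlift.
  rewrite big_ord_recl unlift_none.
  under eq_bigr do rewrite liftK.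
  have [c0 | c0 Bc] := eqVneq (c ord0) 0.
    rewrite c0 scale0r add0r => Bc i; case: (unliftP ord0 i) => [j ->|->//].
    exact: (fi (fun i => c (lift ord0 i))).
  exfalso; apply: nB; exists (fun i => - (c ord0)^-1 * c (lift ord0 i)).
  have := BZ (c ord0)^-1 _ Bc.
  rewrite scalerDr scalerA mulVf // scale1r scaler_sumr.
  rewrite -sumrN; congr (B (_ + _)); apply: eq_bigr => i _.
  by rewrite mulNr scaleNr opprK scalerA.
exists [ffun i => c i]; split=> [|c'].
  by under eq_bigr do rewrite ffunE.
move=> Bc'; apply/ffunP => i; rewrite ffunE; apply/eqP; rewrite -subr_eq0.
have := BD _ _ Bc' (BZ (-1) _ Bc).
rewrite scaleN1r opprB addrC subrKA -sumrN -big_split /=.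
under eq_bigr do rewrite -scaleNr -scalerDl.
by move=> /(fi (fun i => c i - c' i)) ->.
Qed.

(** * Germs and ideals of finite support *)

(** The structure sheaf as an ideal of itself, so that the rules for stalks of ideals also apply to
    germs of regular functions. *)
Program Definition unit_ideal (R : realType) (X : funspace R) : ideal_sheaf X :=
  @IdealSheaf R X (@regular R X) _ _ _ _ _ _.
Next Obligation. by []. Qed.
Next Obligation. by move=> R X U V f _ oV VU; exact: regular_restrict. Qed.
Next Obligation. by move=> R X; exact: regular_local. Qed.
Next Obligation. by move=> R X U; exact: regular_cst. Qed.
Next Obligation. by move=> R X; exact: regularD. Qed.
Next Obligation. by move=> R X; exact: regularM. Qed.

Section Germs.
Context (R : realType) (X : funspace R).
Local Notation C := R[i].
Implicit Types (x : X) (f g : X -> C) (J : ideal_sheaf X).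

(** Germs are represented by functions on all of [X], and identities between germs hold only near
    the point; membership is transported along such identities. *)
Lemma stalk_near J x f g :
  stalk J x f -> (\forall y \near x, f y = g y) -> stalk J x g.
Proof.
move=> [U [oU Ux Jf]]; rewrite -filter_of_nearI nbhsE => -[V [oV Vx] fg].
exists (U `&` V); split=> //; first exact: openI.
apply: ideal_local; first exact: openI.
move=> y [Uy Vy]; exists (U `&` V), f; split=> //; first exact: openI.
  by apply: ideal_restrict Jf => //; exact: openI.
by move=> z [_ Vz] _; rewrite fg.
Qed.

Lemma stalk_regular J x f : stalk J x f -> stalk regular x f.
Proof. by move=> [U [oU Ux /(ideal_regular oU) rf]]; exists U. Qed.

Lemma germ_cst x c : stalk regular x (cst c : X -> C).
Proof. by exists setT; split=> //; [exact: openT|exact/regular_cst/openT]. Qed.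

Lemma stalk0 J x : stalk J x 0.
Proof. by exists setT; split=> //; [exact: openT|exact/ideal0/openT]. Qed.

Lemma stalkD J x f g : stalk J x f -> stalk J x g -> stalk J x (f + g).
Proof.
move=> [U [oU Ux Jf]] [V [oV Vx Jg]]; have oUV := openI oU oV.
exists (U `&` V); split=> //; apply: idealD => //.
  by apply: ideal_restrict Jf => //; exact: subIsetl.
by apply: ideal_restrict Jg => //; exact: subIsetr.
Qed.

Lemma stalkMl J x f g : stalk regular x f -> stalk J x g -> stalk J x (f * g).
Proof.
move=> [U [oU Ux rf]] [V [oV Vx Jg]]; have oUV := openI oU oV.
exists (U `&` V); split=> //; apply: idealM => //.
  by apply: regular_restrict rf => //; exact: subIsetl.
by apply: ideal_restrict Jg => //; exact: subIsetr.
Qed.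

Lemma stalkMr J x f g : stalk J x f -> stalk regular x g -> stalk J x (f * g).
Proof. by move=> Jf rg; rewrite mulrC; exact: stalkMl. Qed.

Lemma stalkZ J x c f : stalk J x f -> stalk J x (fun y => c * f y).
Proof. exact/stalkMl/germ_cst. Qed.

Lemma stalkN J x f : stalk J x f -> stalk J x (- f).
Proof. move=> /(stalkZ (-1))/stalk_near; apply; near=> y.
by rewrite fctE mulN1r.
Unshelve. all: end_near. Qed.

Lemma stalkB J x f g : stalk J x f -> stalk J x g -> stalk J x (f - g).
Proof. by move=> Jf /stalkN; exact: stalkD. Qed.

Lemma stalk_sum J x (I : Type) (r : seq I) (P : pred I) (F : I -> X -> C) :
  (forall i, P i -> stalk J x (F i)) -> stalk J x (\sum_(i <- r | P i) F i).
Proof.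
move=> JF; apply: (big_ind (stalk J x)) => //; first exact: stalk0.
exact: stalkD.
Qed.

Lemma stalk_trans J x f g h :
  stalk J x (f - g) -> stalk J x (g - h) -> stalk J x (f - h).
Proof. by move=> /stalkD/[apply]; rewrite subrKA. Qed.

Lemma stalk_sym J x f g : stalk J x (f - g) -> stalk J x (g - f).
Proof. by move=> /stalkN; rewrite opprB. Qed.

Lemma germD x f g :
  stalk regular x f -> stalk regular x g -> stalk regular x (f + g).
Proof. exact: (@stalkD (unit_ideal X)). Qed.

Lemma germB x f g :
  stalk regular x f -> stalk regular x g -> stalk regular x (f - g).
Proof. exact: (@stalkB (unit_ideal X)). Qed.

Lemma germM x f g :
  stalk regular x f -> stalk regular x g -> stalk regular x (f * g).
Proof. exact: (@stalkMl (unit_ideal X)). Qed.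

Lemma germX x f n : stalk regular x f -> stalk regular x (f ^+ n).
Proof.
move=> rf; elim: n => [|n IH]; first exact: (germ_cst x 1).
by rewrite exprS; exact: germM.
Qed.

Lemma germ_sum x (I : Type) (r : seq I) (P : pred I) (F : I -> X -> C) :
  (forall i, P i -> stalk regular x (F i)) ->
  stalk regular x (\sum_(i <- r | P i) F i).
Proof. exact: (@stalk_sum (unit_ideal X)). Qed.

Lemma germ_near x f g :
  stalk regular x f -> (\forall y \near x, f y = g y) -> stalk regular x g.
Proof. exact: (@stalk_near (unit_ideal X)). Qed.

Lemma germ_neq0 x f : stalk regular x f -> f x != 0 ->
  \forall y \near x, f y != 0.
Proof.
move=> [U [oU Ux rf]] fx; rewrite -filter_of_nearI nbhsE.
exists (U `&` [set y | f y != 0]); last by move=> y [].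
by split=> //; exact: regular_neq0_open.
Qed.

Lemma germV x f : stalk regular x f -> f x != 0 ->
  stalk regular x (fun y => (f y)^-1).
Proof.
move=> [U [oU Ux rf]] fx; have oW := regular_neq0_open oU rf.
exists (U `&` [set y | f y != 0]); split=> //; apply: regularV => //.
  by apply: regular_restrict rf => //; exact: subIsetl.
by move=> y [].
Qed.

Lemma stalk_cancel J x f g : stalk regular x f -> f x != 0 ->
  stalk J x (f * g) -> stalk J x g.
Proof.
move=> rf fx /(stalkMl (germV rf fx))/stalk_near; apply.
near=> y; have fy : f y != 0 by near: y; exact: germ_neq0.
by rewrite fctE mulKf.
Unshelve. all: end_near. Qed.

Lemma stalk_nonvanishing J x f :
  ~ vanishing J x -> stalk regular x f -> stalk J x f.
Proof.
by move=> /contrapT J1 rf; rewrite -[f]mulr1; exact: stalkMl.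
Qed.

Lemma regular_stalk (U : set X) f :
  open U -> (forall x, U x -> stalk regular x f) -> regular U f.
Proof.
move=> oU rf; apply: regular_local => // x /rf[V [oV Vx rV]].
by exists V, f.
Qed.

Lemma near_isolated x (S : set X) : accessible_space X -> finite_set S ->
  \forall y \near x, S y -> y = x.
Proof.
move=> /accessible_finite_set_closed X1 fS.
have /X1 : finite_set (S `\ x) by apply: sub_finite_set fS => y [].
rewrite -openC => oS; rewrite -filter_of_nearI nbhsE; exists (~` (S `\ x)).
  by split=> // -[_]; apply.
by move=> y nS Sy; apply: contrapT => yx; exact: nS.
Qed.

(** Near [x] every point other than [x] lies off the support, where [J] contains all regular germs;
    so the compatibility of nearby germs is automatic. *)
Lemma quotient_sectionE J (U : set X) (s : X -> X -> C) :
  accessible_space X -> finite_set (vanishing J) -> open U ->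
  quotient_section J U s <-> forall x, U x -> stalk regular x (s x).
Proof.
move=> X1 fJ oU; split=> [Js x /Js[V [oV Vx _ rs _]]|rs x Ux].
  by exists V.
have [V [oV Vx rV]] := rs x Ux.
have := near_isolated x X1 fJ.
rewrite -filter_of_nearI nbhsE => -[W [oW Wx] JW].
have oVW : open (V `&` W `&` U) by do 2?apply: openI.
exists (V `&` W `&` U); split=> //.
  by apply: regular_restrict rV => // y [[]].
move=> y [[Vy Wy] Uy]; have [Jy|nJy] := pselect (vanishing J y).
  by rewrite (JW _ Wy Jy) subrr; exact: stalk0.
apply: stalk_nonvanishing => //; apply: germB; last exact: rs.
by exists V.
Qed.

(** An ideal of the local ring at [x], represented by functions and hence closed under equality near
    [x]. *)
Record germ_ideal x (K : set (X -> C)) : Prop := GermIdeal {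
  germ_ideal_regular : forall f, K f -> stalk regular x f;
  germ_ideal_near : forall f g, K f -> (\forall y \near x, f y = g y) -> K g;
  germ_ideal0 : K 0;
  germ_idealD : forall f g, K f -> K g -> K (f + g);
  germ_idealM : forall f g, stalk regular x f -> K g -> K (f * g)
}.

(** * Ideal sheaves with prescribed stalks at finitely many points *)

Section Skyscraper.
Context (K : X -> set (X -> C)) (S : set X).
Hypotheses (K_ideal : forall x, germ_ideal x (K x)) (S_fin : finite_set S).
Hypothesis K_out : forall x f, ~ S x -> stalk regular x f -> K x f.
Hypothesis X1 : accessible_space X.

Program Definition skyscraper_ideal : ideal_sheaf X :=
  @IdealSheaf R X (fun U => [set f | regular U f /\ forall x, U x -> K x f])
    _ _ _ _ _ _.
Next Obligation. by move=> U f _ []. Qed.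
Next Obligation.
move=> U V f _ oV VU [rf Kf]; split; first exact: regular_restrict rf.
by move=> x /VU; exact: Kf.
Qed.
Next Obligation.
move=> U f oU H; split.
  apply: regular_local => // x /H[V [g [oV Vx [rg _] fg]]].
  by exists V, g.
move=> x Ux; have [V [g [oV Vx [_ Kg] fg]]] := H x Ux.
apply: (germ_ideal_near (K_ideal x)) (Kg x Vx) _.
rewrite -filter_of_nearI nbhsE.
exists (U `&` V); first by split=> //; exact: openI.
by move=> y [Uy Vy] /=; rewrite fg.
Qed.
Next Obligation.
move=> U oU; split=> [|x _]; first exact: regular_cst.
exact: germ_ideal0 (K_ideal x).
Qed.
Next Obligation.
move=> U f g oU [rf Kf] [rg Kg]; split=> [|x Ux]; first exact: regularD.
by apply: (germ_idealD (K_ideal x)); [exact: Kf|exact: Kg].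
Qed.
Next Obligation.
move=> U f g oU rf [rg Kg]; split=> [|x Ux]; first exact: regularM.
by apply: (germ_idealM (K_ideal x)); [exists U|exact: Kg].
Qed.

(** The domain of a representative is shrunk until it meets [S] at most in [x]; at all other points
    [K] imposes nothing on regular germs. *)
Lemma stalk_skyscraper x f : stalk skyscraper_ideal x f <-> K x f.
Proof.
split=> [[U [oU Ux [_ Kf]]]|Kf]; first exact: Kf.
have [U [oU Ux rf]] := germ_ideal_regular (K_ideal x) Kf.
have := near_isolated x X1 S_fin.
rewrite -filter_of_nearI nbhsE => -[W [oW Wx] SW].
have oUW := openI oU oW.
exists (U `&` W); split=> //; split.
  by apply: regular_restrict rf => //; exact: subIsetl.
move=> y [Uy Wy]; have [Sy|nSy] := pselect (S y); first by rewrite (SW _ Wy Sy).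
by apply: K_out => //; exists U.
Qed.

Lemma vanishing_skyscraper : vanishing skyscraper_ideal `<=` S.
Proof.
move=> x Kx; apply: contrapT => nSx; apply: Kx.
by apply/stalk_skyscraper/K_out => //; exact: germ_cst.
Qed.

End Skyscraper.

End Germs.

(** * Separation of finite subschemes by sections *)

Section LineBundles.
Context (R : realType) (X : funspace R).
Local Notation C := R[i].
Implicit Types (L : line_bundle X) (J : ideal_sheaf X).

Lemma lb_trans_id L (i : lb_idx L) x : lb_dom i x -> lb_trans i i x = 1.
Proof.
move=> xi; have := lb_cocycle xi xi xi.
by rewrite -[RHS]mulr1 => /mulfI; apply; exact: lb_neq0.
Qed.

Lemma germ_lb_trans L (i j : lb_idx L) x :
  lb_dom i x -> lb_dom j x -> stalk regular x (lb_trans i j).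
Proof.
move=> xi xj; exists (lb_dom i `&` lb_dom j); split=> //.
  by apply: openI; exact: lb_open.
exact: lb_regular.
Qed.

Lemma near_lb_dom L (i : lb_idx L) x :
  lb_dom i x -> \forall y \near x, lb_dom i y.
Proof. by move=> xi; apply: open_nbhs_nbhs; split=> //; exact: lb_open. Qed.

Lemma global_sectionD L (s t : lb_idx L -> X -> C) :
  global_section L s -> global_section L t ->
  global_section L (fun i => s i + t i).
Proof.
move=> [rs sE] [rt tE]; split=> [i|i j x xi xj].
  by apply: regularD => //; exact: lb_open.
by rewrite !fctE (sE i j) // (tE i j) // mulrDr.
Qed.

Lemma global_section0 L : global_section L (fun _ => 0).
Proof.
split=> [i|i j x _ _]; last by rewrite mulr0.
exact/(regular_cst 0)/lb_open.
Qed.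

Definition chart_choice L (c : X -> lb_idx L) := forall x, lb_dom (c x) x.

(** For finite support this is surjectivity of the restriction of sections of [L] to the scheme of
    [J]: once [L] is trivialised at each [x] in the chart [c x], the target consists of arbitrary
    families of germs. *)
Definition separates L J (c : X -> lb_idx L) :=
  forall a : X -> X -> C, (forall x, stalk regular x (a x)) ->
  exists2 s, global_section L s & forall x, stalk J x (s (c x) - a x).
Arguments separates : clear implicits.

Lemma separates_sub L J J' (c : X -> lb_idx L) :
  (forall x f, stalk J x f -> stalk J' x f) ->
  separates L J c -> separates L J' c.
Proof.
move=> JJ' + a ra => /(_ a ra)[s gs sa].
by exists s => // x; exact: JJ'.
Qed.

Lemma k_very_ample_separates L J c k n : accessible_space X ->
  chart_choice c -> k_very_ample L k -> n%:Z = k + 1 ->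
  zero_dim_subscheme J n -> separates L J c.
Proof.
move=> X1 cP Lk nk Jn a ra.
(* The germ prescribed at [x] in the chart [c x], read in the chart [i]; the cocycle condition makes
   these compatible. *)
pose t i x := lb_trans i (c x) * a x.
have rt i x : lb_dom i x -> stalk regular x (t i x).
  by move=> xi; apply: germM => //; exact: germ_lb_trans.
have [|s gs st] := Lk J n nk Jn t.
  split=> [i|i j x xi xj].
    by apply/quotient_sectionE => //; [exact: Jn.1|exact: lb_open|exact: rt].
  apply: stalk_near (stalk0 J x) _; near=> y.
  have yi : lb_dom i y by near: y; exact: near_lb_dom.
  have yj : lb_dom j y by near: y; exact: near_lb_dom.
  have yc : lb_dom (c x) y by near: y; exact: near_lb_dom.
  by rewrite !fctE /t !fctE mulrA lb_cocycle // subrr.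
exists s => // x; apply: stalk_near (st (c x) x (cP x)) _; near=> y.
have yc : lb_dom (c x) y by near: y; exact: near_lb_dom.
by rewrite !fctE /t !fctE lb_trans_id // mul1r.
Unshelve. all: end_near. Qed.

Lemma separates_twisted_section L J c t : chart_choice c -> separates L J c ->
  twisted_section L J t ->
  exists2 s, global_section L s &
    forall i x, lb_dom i x -> stalk J x (s i - t i x).
Proof.
move=> cP Jc [qt tE].
have rt i x : lb_dom i x -> stalk regular x (t i x).
  by move=> /qt[V [oV Vx _ rV _]]; exists V.
have [x|s gs st] := Jc (fun x => t (c x) x); first exact: rt.
exists s => // i x xi.
apply: (@stalk_trans _ _ _ _ _ (lb_trans i (c x) * t (c x) x)).
  apply: stalk_near (stalkMl (germ_lb_trans xi (cP x)) (st x)) _; near=> y.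
  have yi : lb_dom i y by near: y; exact: near_lb_dom.
  have yc : lb_dom (c x) y by near: y; exact: near_lb_dom.
  by rewrite !fctE (gs.2 i (c x)) // mulrBr.
exact/stalk_sym/tE.
Unshelve. all: end_near. Qed.

(** On one point every function is constant, hence regular. The case is treated apart because there
    are no further points to enlarge a subscheme with. *)
Lemma separates_point L J c :
  (forall x y : X, x = y) -> @chart_choice L c -> separates L J c.
Proof.
move=> X1 cP a _.
have all_regular (U : set X) (f : X -> C) : open U -> regular U f.
  move=> oU; apply: regular_local => // x Ux; exists U, (cst (f x)); split=> //.
    exact: regular_cst.
  by move=> y _ _; rewrite (X1 y x).
exists (fun i x => lb_trans i (c x) x * a x x).
  split=> [i|i j x xi xj]; first exact/all_regular/lb_open.
  by rewrite mulrA lb_cocycle.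
move=> x; apply: stalk_near (stalk0 J x) _; near=> y.
by rewrite (X1 y x) !fctE lb_trans_id // mul1r subrr.
Unshelve. all: end_near. Qed.

(** [J'] consists of the germs of [J] that moreover vanish at [x]; since [x] is off the support of
    [J], this adds a reduced point and one dimension. *)
Lemma zero_dim_add_point J n x : accessible_space X ->
  zero_dim_subscheme J n -> ~ vanishing J x ->
  exists2 J', zero_dim_subscheme J' n.+1 &
    forall y f, stalk J' y f -> stalk J y f.
Proof.
move=> X1 [fJ [e [re eE]]] nJx.
have qE J' (f : X -> X -> C^o) : finite_set (vanishing J') ->
    quotient_section J' setT f <-> forall y, stalk regular y (f y).
  move=> fJ'; rewrite quotient_sectionE //; last exact: openT.
  by split=> [rf y|rf y _]; exact: rf.
pose K y : set (X -> C) := [set f | stalk J y f /\ (y = x -> f y = 0)].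
have Kid y : germ_ideal y (K y).
  split.
  - by move=> f [/stalk_regular].
  - move=> f g [Jf fx] fg; split=> [|/fx]; first exact: stalk_near Jf fg.
    by rewrite (nbhs_singleton fg).
  - by split=> //; exact: stalk0.
  - move=> f g [Jf fx] [Jg gx]; split=> [|yx]; first exact: stalkD.
    by rewrite fctE fx // gx // addr0.
  - move=> f g rf [Jg gx]; split=> [|yx]; first exact: stalkMl.
    by rewrite fctE gx // mulr0.
have fS : finite_set (vanishing J `|` [set x]).
  by rewrite finite_setU; split=> //; exact: finite_set1.
have Kout y f : ~ (vanishing J `|` [set x]) y -> stalk regular y f -> K y f.
  move=> nS rf; split=> [|yx]; last by case: nS; right.
  by apply: stalk_nonvanishing => // Jy; apply: nS; left.
pose J' := skyscraper_ideal Kid.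
have J'K y f : stalk J' y f <-> K y f.
  exact: (stalk_skyscraper Kid fS Kout X1).
have fJ' : finite_set (vanishing J').
  exact: (sub_finite_set (@vanishing_skyscraper _ _ _ _ Kid fS Kout X1) fS).
exists J'; last by move=> y f /J'K[].
split=> //.
(* The additional basis element: it is zero modulo [J] and takes the value 1 at [x]. *)
pose delta (y : X) : X -> C^o := if y == x then cst 1 else 0.
have rd y : stalk regular y (delta y).
  rewrite /delta; case: ifP => _; exact: germ_cst.
have Jd c y : stalk J y (c *: delta y).
  rewrite /delta; case: eqP => [->|_]; last by rewrite scaler0; exact: stalk0.
  by apply: stalk_nonvanishing => //; exact: (germ_cst x (c * 1)).
exists (fun i => if unlift ord0 i is Some j then e j else delta); split.
  move=> i; apply/qE => // y; case: unlift => [j|]; last exact: rd.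
  by move/qE: (re j); apply.
move=> f /qE rf; have {}rf := rf fJ'.
have [|c [Jc c_uniq]] := eE f; first exact/qE.
pose g := f - \sum_i c i *: e i.
(* The coefficient of [delta] is the value at [x] of the remainder [g]. *)
pose c' := [ffun i => if unlift ord0 i is Some j then c j else g x x].
have sumE (b : {ffun 'I_n.+1 -> C}) : \sum_i b i *:
    (if unlift ord0 i is Some j then e j else delta) =
    b ord0 *: delta + \sum_i b (lift ord0 i) *: e i.
  rewrite big_ord_recl unlift_none; congr (_ + _).
  by apply: eq_bigr => i _; rewrite liftK.
exists c'; split=> [y _|b Jb].
  rewrite sumE ffunE unlift_none.
  under eq_bigr do rewrite ffunE liftK.
  rewrite opprD addrCA addrC -/g; apply/J'K; split=> [|->].
    by apply: stalkB; [exact: (Jc y)|exact: Jd].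
  by rewrite !fctE /delta eqxx /= [_ *: 1]mulr1 subrr.
have bc : [ffun i => b (lift ord0 i)] = c.
  apply/esym/c_uniq => y _; under eq_bigr do rewrite ffunE.
  have /J'K[Jby _] := Jb y I.
  move: (stalkD (Jd (b ord0) y) Jby); rewrite sumE.
  rewrite -[X in stalk _ _ X -> _]/((b ord0 *: delta + (f - (_ + _))) y).
  by rewrite opprD [f + _]addrCA addNKr.
apply/ffunP => i; rewrite ffunE.
case: (unliftP ord0 i) => [j ->|->]; first by rewrite -bc ffunE.
have /J'K[_ /(_ erefl)] := Jb x I; rewrite sumE.
rewrite (eq_bigr (fun i => c i *: e i)); last by move=> j _; rewrite -bc ffunE.
rewrite opprD addrCA addrC -/g !fctE /delta eqxx /= [_ *: 1]mulr1.
by move=> /eqP; rewrite subr_eq0 => /eqP.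
Qed.

(** Very ampleness speaks of one exact length, so shorter subschemes are enlarged by reduced points,
    one at a time, chosen off the finite support. *)
Lemma zero_dim_enlarge J m n : accessible_space X ->
  infinite_set [set: X] -> zero_dim_subscheme J m -> (m <= n)%N ->
  exists2 J', zero_dim_subscheme J' n &
    forall y f, stalk J' y f -> stalk J y f.
Proof.
move=> X1 Xinf + /subnKC <-; elim: (n - m)%N => [|r IH] Jm.
  by exists J; rewrite ?addn0.
have [J' J'm J'J] := IH Jm.
have [x nJ'x] : exists x, ~ vanishing J' x.
  apply: contrapT => nx; apply: Xinf; apply: sub_finite_set J'm.1 => x _.
  by apply: contrapT => nJ'x; apply: nx; exists x.
have [J'' J''m J''J'] := zero_dim_add_point X1 J'm nJ'x.
by exists J''; rewrite ?addnS // => y f /J''J'; exact: J'J.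
Qed.

End LineBundles.
Arguments separates {R X} L J c.

(** * Points are closed *)

Lemma proj_space_accessible (R : realType) n :
  accessible_space (proj_space R n).
Proof.
move=> l m lm; have [e e0 le] := line_gen l; have [f f0 mf] := line_gen m.
have /rV0Pn[i fi] := f0.
(* The common zeros of these linear forms are the multiples of [f], because [f ord0 i] is nonzero;
   hence one of them does not vanish on [l]. *)
pose p j : {mpoly R[i][n.+1]} := f ord0 i *: 'X_j - f ord0 j *: 'X_i.
have hp j : p j \is 1.-homog.
  by apply: rpredB; apply: rpredZ; rewrite dhomogX; apply/eqP; exact: mdeg1.
have pE j (v : 'rV_n.+1) :
    (p j).@[v ord0] = f ord0 i * v ord0 j - f ord0 j * v ord0 i.
  by rewrite mevalB !mevalZ !mevalXU.
have [j pj] : exists j, (p j).@[e ord0] != 0.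
  apply: contrapT => np; move/eqP: lm; apply.
  pose a := e ord0 i / f ord0 i.
  have ea : e = a *: f.
    apply/rowP => j; rewrite mxE /a mulrAC.
    apply: (mulIf fi); rewrite mulfVK //; apply/eqP.
    rewrite -subr_eq0 mulrC [e _ i * _]mulrC -pE; apply/negPn/negP => ?.
    by apply: np; exists j.
  have a0 : a != 0 by apply: contraNneq e0 => a0; rewrite ea a0 scale0r.
  have : line l = line m.
    apply/vspaceP => v; apply/idP/idP => [/le[c ->]|/mf[c ->]].
      by apply/mf; exists (c * a); rewrite ea scalerA.
    by apply/le; exists (c / a); rewrite ea scalerA mulfVK.
  case: (l) (m) => [l' dl] [m' dm] /= lm; move: dl dm; rewrite lm => dl dm.
  by congr ProjPt; exact: Prop_irrelevance.
exists (nonvanishing (p j)); split; rewrite ?in_setE.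
- exact: nonvanishing_open (hp j).
- exact/(nonvanishing_gen (hp j) e0 le).
- by move/(nonvanishing_gen (hp j) f0 mf); rewrite pE mulrC subrr eqxx.
Qed.

Lemma subfunspace_accessible (R : realType) (X : funspace R) (A : set X) :
  accessible_space X -> accessible_space (subfunspace A).
Proof.
move=> X1 x y xy; have [|U [oU /set_mem Ux /set_mem Uy]] := X1 (val x) (val y).
  by apply: contra_neq xy; exact: val_inj.
by exists (set_val @^-1` U); split; rewrite ?in_setE //; exists U.
Qed.

Lemma isomorphic_accessible (R : realType) (X Y : funspace R) :
  isomorphic X Y -> accessible_space Y -> accessible_space X.
Proof.
move=> [f [g [fK gK]]] Y1 x y xy.
have [|U [oU /set_mem Ux /set_mem Uy]] := Y1 (f x) (f y).
  by apply: contra_neq xy => /(congr1 g); rewrite !fK.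
by exists (f @^-1` U); split; rewrite ?in_setE //; exact: morphism_open.
Qed.

Lemma projective_variety_accessible (R : realType) (X : funspace R) :
  projective_variety X -> accessible_space X.
Proof.
move=> [n [A [_ _ XA]]]; apply: isomorphic_accessible XA _.
exact/subfunspace_accessible/proj_space_accessible.
Qed.

(** A finite T1 space is the union of two closed sets, one point and its complement; irreducibility
    leaves only the point. *)
Lemma projective_variety_point (R : realType) (X : funspace R) :
  projective_variety X -> finite_set [set: X] -> forall x y : X, x = y.
Proof.
move=> [n [A [_ [[a Aa] Airr] [f [g [fK gK]]]]]] fX.
have /accessible_finite_set_closed P1 := @proj_space_accessible R n.
have fA : finite_set A.
  apply: sub_finite_set (finite_image (fun x => val (f x)) fX) => b Ab.
  by exists (g (exist _ b (mem_set Ab))) => //=; rewrite gK.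
have ca : closed [set a] := P1 _ (finite_set1 a).
have cA : closed (A `\ a) by apply: P1; apply: sub_finite_set fA => b [].
have AE : A `<=` [set a] `|` (A `\ a).
  by move=> b Ab; have [->|ba] := pselect (b = a); [left|right].
have [A1 x y|/(_ a Aa)[_ []//]] := Airr _ _ ca cA AE.
rewrite -[x]fK -[y]fK; congr (g _); apply: val_inj.
by rewrite (A1 _ (set_mem (valP (f x)))) (A1 _ (set_mem (valP (f y)))).
Qed.

Lemma total_pt_eq (R : realType) (X : funspace R) (M : line_bundle X)
    (i : lb_idx M) (y z : total_pt M) :
  tp_base y = tp_base z -> lb_dom i (tp_base y) ->
  tp_coord y i = tp_coord z i -> y = z.
Proof.
case: y z => [x u ut uj] [x' v vt vj] /= xx'; subst x' => xi uv.
have {}uv : u = v.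
  apply/funext => j; have [xj|xj] := pselect (lb_dom j x).
    by rewrite (ut j i) // (vt j i) // uv.
  by rewrite uj // vj.
by subst v; congr TotalPt; exact: Prop_irrelevance.
Qed.

(** Points over different base points are separated on [X], and two points of one fibre by the fibre
    coordinate minus its value at [z]. *)
Lemma total_space_accessible (R : realType) (X : funspace R)
    (M : line_bundle X) :
  accessible_space X -> accessible_space (total_space M).
Proof.
move=> X1 y z yz; have [yzb|] := eqVneq (tp_base y) (tp_base z); last first.
  move=> /X1[U [oU /set_mem Uy /set_mem Uz]].
  exists (total_proj M @^-1` U); split; rewrite ?in_setE //.
  exact: morphism_open.
have [i yi] := lb_cover M (tp_base y).
pose f := @tautological _ _ M i - cst (tp_coord z i).
pose U : set (total_space M) := total_proj M @^-1` lb_dom i.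
have oU : open U.
  exact: (morphism_open (total_proj M) (lb_open i)).
have rf : regular U f.
  apply: (@regularD _ (total_space M)) => //.
    exact: (tautological_section M).1.
  exact: (@regular_cst _ (total_space M) _ (- tp_coord z i)).
exists (U `&` [set w | f w != 0]).
split; rewrite ?in_setE.
- exact: (@regular_neq0_open _ (total_space M)).
- split=> //=; rewrite /f !fctE subr_eq0.
  by apply: contra_neq yz; exact: total_pt_eq.
- by move=> [_]; rewrite /= /f !fctE subrr eqxx.
Qed.

(** * Germs on the cyclic cover modulo an ideal of finite colength *)

Section FiniteLength.
Context (R : realType) (Y : funspace R) (J : ideal_sheaf Y) (n : nat).
Local Notation C := R[i].
Hypotheses (Y1 : accessible_space Y) (J_fin : zero_dim_subscheme J n).

Lemma germ_horner (P : {poly C}) (u : Y -> C) y :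
  stalk regular y u -> stalk regular y (fun z => P.[u z]).
Proof.
move=> ru; have -> : (fun z => P.[u z]) = \sum_(i < size P) cst P`_i * u ^+ i.
  apply/funext => z; rewrite horner_coef fct_sumE.
  by apply: eq_bigr => i _; rewrite !fctE.
by apply: germ_sum => i _; apply: germM; [exact: germ_cst|exact: germX].
Qed.

(** The [n.+1] powers of [u] up to [u ^+ n], placed at [y] and extended by zero, are dependent in an
    algebra of dimension [n]. *)
Lemma stalk_algebraic (u : Y -> C) y : stalk regular y u ->
  exists P : {poly C}, [/\ P != 0, (size P <= n.+1)%N &
    stalk J y (fun z => P.[u z])].
Proof.
move=> ru; pose f (i : 'I_n.+1) : Y -> Y -> C^o :=
  fun y' => if y' == y then u ^+ i else 0.
have [c [[i ci] /(_ y I) Jc]] : exists c : 'I_n.+1 -> C,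
    (exists i, c i != 0) /\ quotient_zero J setT (\sum_i c i *: f i).
  apply: (quotient_dim_dependent _ _ _ J_fin.2); last by rewrite card_ord.
  - by move=> z _; exact: stalk0.
  - by move=> g h Jg Jh z _; apply: stalkD; [exact: Jg|exact: Jh].
  - by move=> a g Jg z _; apply: stalkZ; exact: Jg.
  move=> i; apply/quotient_sectionE => //; [exact: J_fin.1|exact: openT|].
  move=> z _; rewrite /f; case: eqP => [->|_]; first exact: germX.
  exact: (germ_cst z 0).
exists (\poly_(j < n.+1) c (inord j)); split.
- apply: contra_neq ci => /(congr1 (fun P : {poly C} => P`_i)).
  by rewrite coef_poly ltn_ord coef0 inord_val.
- exact: size_poly.
apply: stalk_near Jc _; near=> z.
rewrite !fct_sumE horner_poly; apply: eq_bigr => j _.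
by rewrite inord_val /f /= !fctE eqxx.
Unshelve. all: end_near. Qed.

(** In a relation [P = Q * 'X^m] with [Q.[0] != 0] the factor [Q.[u]] is a unit at [y], so [u ^+ m]
    lies in the stalk, and [m <= n] by degrees. *)
Lemma stalk_nilpotent (u : Y -> C) y :
  stalk regular y u -> u y = 0 -> stalk J y (u ^+ n).
Proof.
move=> ru uy0; have [P [P0 sP JP]] := stalk_algebraic ru.
have [m [Q]] := multiplicity_XsubC P 0; rewrite P0 subr0 /= => Q0 PE.
have Qn0 : Q != 0 by apply: contraNneq Q0 => ->; rewrite root0.
have mn : (m <= n)%N.
  move: sP; rewrite PE size_mulXn //.
  have : (0 < size Q)%N by rewrite size_poly_gt0.
  by case: (size Q) => // r _; rewrite addnS ltnS; exact/leq_trans/leq_addr.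
have : stalk J y ((fun z => Q.[u z]) * u ^+ m).
  apply: stalk_near JP _; near=> z.
  by rewrite PE hornerM hornerXn !fctE.
move=> /(stalk_cancel (germ_horner Q ru)).
rewrite uy0 => /(_ Q0) Jm; rewrite -(subnK mn) exprD.
by apply: stalkMl => //; exact: germX.
Unshelve. all: end_near. Qed.

(** The inverse is again a polynomial in [u], which keeps inversion within polynomials in the fibre
    coordinate. In a relation [Q * 'X^m] the power of [u] cancels, and [Q = W * 'X + Q.[0]] gives
    the inverse [- W / Q.[0]]. *)
Lemma stalk_inverse (u : Y -> C) y : stalk regular y u -> u y != 0 ->
  exists W : {poly C}, stalk J y (cst 1 - u * (fun z => W.[u z])).
Proof.
move=> ru uy0; have [P [P0 sP JP]] := stalk_algebraic ru.
have [m [Q]] := multiplicity_XsubC P 0; rewrite P0 subr0 /= => Q0 PE.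
have JQ : stalk J y (fun z => Q.[u z]).
  have um : (u ^+ m) y != 0 by rewrite fctE expf_neq0.
  apply: (stalk_cancel (germX m ru) um); apply: stalk_near JP _; near=> z.
  by rewrite PE hornerM hornerXn !fctE mulrC.
have : root (Q - Q.[0]%:P) 0 by rewrite rootE !hornerE subrr.
move=> /factor_theorem[W QE].
exists (- Q.[0]^-1 *: W); apply: stalk_near (stalkZ Q.[0]^-1 JQ) _; near=> z.
have -> : Q.[u z] = W.[u z] * u z + Q.[0].
  rewrite [in LHS](_ : Q = W * 'X + Q.[0]%:P) ?hornerE //.
  by apply/eqP; rewrite -subr_eq QE polyC0 subr0.
rewrite !fctE hornerZ mulrDr mulVf //.
by ring.
Unshelve. all: end_near. Qed.

End FiniteLength.

(** * Polynomials in the fibre coordinate over the functions on [X] *)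

Section CyclicSpan.
Context (R : realType) (X : funspace R) (M : line_bundle X) (d : nat).
Context (s : lb_idx (lb_pow M d) -> X -> R[i]).
Local Notation C := R[i].
Local Notation Y := (cyclic_cover s).
Local Notation proj := (cyclic_proj s).
Context (J : ideal_sheaf Y) (c : X -> lb_idx M).
Hypotheses (d_gt0 : (0 < d)%N) (cP : chart_choice c).
Hypothesis s_regular : forall i : lb_idx M, regular (lb_dom i) (s i).

Definition coord (i : lb_idx M) (y : Y) : C := tautological i (sub_incl _ y).

Lemma germ_pull y f : stalk regular (proj y) f -> stalk regular y (f \o proj).
Proof.
move=> [U [oU Uy rf]]; exists (proj @^-1` U); split=> //.
  exact: morphism_open.
exact: morphism_regular.
Qed.

Lemma near_pull y (P : set X) :
  (\forall x \near proj y, P x) -> \forall z \near y, P (proj z).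
Proof.
rewrite -!filter_of_nearI !nbhsE => -[U [oU Uy] UP].
exists (proj @^-1` U); last by move=> z /UP.
by split=> //; exact: morphism_open.
Qed.

Lemma regular_coord i : regular (proj @^-1` lb_dom i : set Y) (coord i).
Proof.
apply: (morphism_regular (sub_incl _) _ ((tautological_section M).1 i)).
exact: (morphism_open (total_proj M) (lb_open i)).
Qed.

Lemma germ_coord i y : lb_dom i (proj y) -> stalk regular y (coord i).
Proof.
move=> yi; exists (proj @^-1` lb_dom i); split=> //.
  by apply: morphism_open; exact: lb_open.
exact: regular_coord.
Qed.

Lemma coord_trans i j y : lb_dom i (proj y) -> lb_dom j (proj y) ->
  coord i y = lb_trans i j (proj y) * coord j y.
Proof. exact: tp_trans. Qed.

Lemma coord_pow i y : lb_dom i (proj y) -> coord i y ^+ d = s i (proj y).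
Proof.
move=> yi; have /set_mem/(_ i yi)/eqP := valP y.
by rewrite subr_eq0 => /eqP ->.
Qed.

Lemma coord_inj i y z : proj y = proj z -> lb_dom i (proj y) ->
  coord i y = coord i z -> y = z.
Proof. by move=> yz yi uv; apply: val_inj; exact: (total_pt_eq yz yi). Qed.

Local Notation t x := (coord (c x)).

(* Over x the family of germs h lies in O_X + O_X t + ... + O_X t^(q-1)
   modulo J, the fibre coordinate t being read in the chart c x. *)
Definition spanned q x (h : Y -> Y -> C) :=
  exists2 a : nat -> X -> C, (forall j, stalk regular x (a j)) &
    forall y, proj y = x ->
      stalk J y (h y - \sum_(j < q) (a j \o proj) * t x ^+ j).

Lemma germ_t y : stalk regular y (t (proj y)).
Proof. exact/germ_coord/cP. Qed.

Lemma spanned_mod q x h h' : spanned q x h ->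
  (forall y, proj y = x -> stalk J y (h' y - h y)) -> spanned q x h'.
Proof.
move=> [a ra ha] hh'; exists a => // y yx.
exact: stalk_trans (hh' y yx) (ha y yx).
Qed.

Lemma spanned0 q x : spanned q x (fun _ => 0).
Proof.
exists (fun _ => cst 0) => [j|y yx]; first exact: germ_cst.
apply: stalk_near (stalk0 J y) _; near=> z.
rewrite !fctE fct_sumE big1 ?subrr // => j _.
by rewrite !fctE mul0r.
Unshelve. all: end_near. Qed.

Lemma spannedD q x h h' :
  spanned q x h -> spanned q x h' -> spanned q x (fun y => h y + h' y).
Proof.
move=> [a ra ha] [b rb hb]; exists (fun j => a j + b j) => [j|y yx].
  exact: germD.
apply: stalk_near (stalkD (ha y yx) (hb y yx)) _; near=> z.
rewrite !fctE !fct_sumE addrACA -opprD -big_split /=; congr (_ - _).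
by apply: eq_bigr => j _; rewrite !fctE mulrDl.
Unshelve. all: end_near. Qed.

Lemma spanned_sum q x n (h : 'I_n -> Y -> Y -> C) :
  (forall i, spanned q x (h i)) -> spanned q x (fun y => \sum_i h i y).
Proof.
elim: n h => [|n IH] h hh.
  apply: spanned_mod (spanned0 q x) _ => y _.
  by rewrite big_ord0 subrr; exact: stalk0.
apply: spanned_mod (spannedD (hh ord0) (IH _ (fun i => hh (lift ord0 i)))) _.
by move=> y _; rewrite big_ord_recl subrr; exact: stalk0.
Qed.

Lemma spannedZ q x f h : stalk regular x f -> spanned q x h ->
  spanned q x (fun y => (f \o proj) * h y).
Proof.
move=> rf [a ra ha]; exists (fun j => f * a j) => [j|y yx]; first exact: germM.
have rfy : stalk regular y (f \o proj) by apply: germ_pull; rewrite yx.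
apply: stalk_near (stalkMl rfy (ha y yx)) _; near=> z.
rewrite !fctE !fct_sumE mulrBr mulr_sumr; congr (_ - _).
by apply: eq_bigr => j _; rewrite !fctE mulrA.
Unshelve. all: end_near. Qed.

Lemma spannedN q x h : spanned q x h -> spanned q x (fun y => - h y).
Proof.
move=> /(spannedZ (germ_cst x (-1)))/spanned_mod; apply=> y _.
apply: stalk_near (stalk0 J y) _; near=> z.
by rewrite !fctE mulN1r subrr.
Unshelve. all: end_near. Qed.

Lemma spanned_tM q x h :
  spanned q x h -> spanned q.+1 x (fun y => t x * h y).
Proof.
move=> [a ra ha].
exists (fun j => if j is j'.+1 then a j' else cst 0) => [[|j]|y yx] //.
  exact: germ_cst.
have rt : stalk regular y (t x) by rewrite -yx; exact: germ_t.
apply: stalk_near (stalkMl rt (ha y yx)) _; near=> z.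
rewrite !fctE !fct_sumE mulrBr mulr_sumr big_ord_recl !fctE mul0r add0r.
by congr (_ - _); apply: eq_bigr => j _; rewrite !fctE exprS mulrCA.
Unshelve. all: end_near. Qed.

Lemma spanned_monomial q x f j : stalk regular x f -> (j < q)%N ->
  spanned q x (fun _ => (f \o proj) * t x ^+ j).
Proof.
move=> rf jq; exists (fun i => if i == j then f else cst 0) => [i|y yx].
  by case: ifP => // _; exact: germ_cst.
apply: stalk_near (stalk0 J y) _; near=> z.
rewrite !fctE !fct_sumE (bigD1 (Ordinal jq)) //= eqxx !fctE.
rewrite big1 ?addr0 ?subrr //.
by move=> i /negPf ij; rewrite -val_eqE /= in ij; rewrite ij !fctE mul0r.
Unshelve. all: end_near. Qed.

(* The relation t^d = s. *)
Lemma spanned_reduce x h : spanned d.+1 x h -> spanned d x h.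
Proof.
move=> [a ra ha].
have rs : stalk regular x (a d * s (c x)).
  apply: germM => //; exists (lb_dom (c x)); split=> //; exact: lb_open.
have lower : spanned d x (fun _ => \sum_(j < d) (a j \o proj) * t x ^+ j).
  by exists a => // y _; rewrite subrr; exact: stalk0.
apply: spanned_mod (spannedD lower (spanned_monomial rs d_gt0)) _ => y yx.
apply: stalk_near (ha y yx) _; near=> z.
have zc : lb_dom (c x) (proj z).
  by near: z; apply: near_pull; rewrite yx; exact: near_lb_dom.
rewrite big_ord_recr /= !fctE; congr (_ - (_ + _)).
by rewrite coord_pow // expr0 mulr1.
Unshelve. all: end_near. Qed.

Lemma spanned_dtM x h : spanned d x h -> spanned d x (fun y => t x * h y).
Proof. by move=> /spanned_tM/spanned_reduce. Qed.

Lemma spanned_dtXM x h j :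
  spanned d x h -> spanned d x (fun y => t x ^+ j * h y).
Proof.
move=> hh; elim: j => [|j /spanned_dtM IH].
  by apply: spanned_mod hh _ => y _; rewrite expr0 mul1r subrr; exact: stalk0.
apply: spanned_mod IH _ => y _.
by rewrite exprS mulrA subrr; exact: stalk0.
Qed.

(** The factor [h] is expanded in powers of [t], and multiplication by these preserves the span
    because of the relation for [t ^+ d]. Regularity of [h'] keeps the error of the expansion in
    [J]. *)
Lemma spannedM x h h' : (forall y, proj y = x -> stalk regular y (h' y)) ->
  spanned d x h -> spanned d x h' -> spanned d x (fun y => h y * h' y).
Proof.
move=> rh' [a ra ha] hh'.
have := @spanned_sum d x d (fun j y => (a j \o proj) * (t x ^+ j * h' y)).
move=> /(_ (fun j => spannedZ (ra j) (spanned_dtXM j hh')))/spanned_mod.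
apply=> y yx; apply: stalk_near (stalkMr (ha y yx) (rh' y yx)) _; near=> z.
rewrite !fctE !fct_sumE mulrBl mulr_suml; congr (_ - _).
by apply: eq_bigr => j _; rewrite !fctE mulrA.
Unshelve. all: end_near. Qed.

(* The germs of a function F that is a polynomial in t over O_X near x. *)
Definition polynomial_at x (F : Y -> C) :=
  (forall y, proj y = x -> stalk regular y F) /\ spanned d x (fun _ => F).

Lemma polynomial_cst x a : polynomial_at x (cst a).
Proof.
split=> [y _|]; first exact: germ_cst.
apply: spanned_mod (spanned_monomial (germ_cst x a) d_gt0) _ => y _.
by rewrite expr0 mulr1 subrr; exact: stalk0.
Qed.

Lemma polynomial_t x : polynomial_at x (t x).
Proof.
split=> [y <-|]; first exact: germ_t.
apply: spanned_mod (spanned_dtM (polynomial_cst x 1).2) _ => y _.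
by rewrite mulr1 subrr; exact: stalk0.
Qed.

Lemma polynomialD x F G :
  polynomial_at x F -> polynomial_at x G -> polynomial_at x (F + G).
Proof.
move=> [rF hF] [rG hG]; split=> [y yx|]; last exact: spannedD.
by apply: germD; [exact: rF|exact: rG].
Qed.

Lemma polynomialM x F G :
  polynomial_at x F -> polynomial_at x G -> polynomial_at x (F * G).
Proof.
move=> [rF hF] [rG hG]; split=> [y yx|]; last exact: spannedM.
by apply: germM; [exact: rF|exact: rG].
Qed.

Lemma polynomialX x F n : polynomial_at x F -> polynomial_at x (F ^+ n).
Proof.
move=> pF; elim: n => [|n IH]; first exact: (polynomial_cst x 1).
by rewrite exprS; exact: polynomialM.
Qed.

Lemma polynomial_horner x F (P : {poly C}) :
  polynomial_at x F -> polynomial_at x (fun y => P.[F y]).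
Proof.
move=> pF; elim/poly_ind: P => [|P a IH].
  rewrite (_ : (fun _ => _) = cst 0); first exact: polynomial_cst.
  by apply/funext => y; rewrite horner0.
rewrite (_ : (fun _ => _) = (fun y => P.[F y]) * F + cst a).
  by apply: polynomialD (polynomial_cst x a); exact: polynomialM.
by apply/funext => y; rewrite hornerMXaddC.
Qed.

Lemma polynomial_fibre_poly x N F : fibre_poly N F -> N x ->
  polynomial_at x (fun y => F (sub_incl _ y)).
Proof.
move=> fF Nx; split=> [y yx|].
  have [_ [oN _ _]] := fF; exists (proj @^-1` N); split=> //.
  - exact: morphism_open.
  - by rewrite -yx in Nx.
  apply: (@morphism_regular _ _ _ (sub_incl (cyclic_locus s)) _ F _
    (fibre_poly_regular fF)).
  exact: (morphism_open (total_proj M) oN).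
have [i [oN Ni cF]] := fF.
(* [F] is polynomial in the coordinate of some chart; near [x] it is rewritten in the coordinate of
   [c x]. *)
pose N' := N `&` lb_dom (c x).
have oN' : open N' by apply: openI => //; exact: lb_open.
have N'N : N' `<=` N by move=> ? [].
have N'c : N' `<=` lb_dom (c x) by move=> ? [].
have [j [_ N'j cF']] := fibre_poly_restrict oN' N'N fF.
have [n [P [sP rP FE]]] := chart_poly_change oN' N'j N'c cF'.
pose a (k : 'I_n) z := (P z)`_k.
have ra k : stalk regular x (a k) by exists N'; split=> //; exact: rP.
have := spanned_sum (fun k =>
  spanned_dtXM k (spannedZ (ra k) (polynomial_cst x 1).2)).
move=> /spanned_mod; apply=> y yx; apply: stalk_near (stalk0 J y) _; near=> z.
have N'z : N' (proj z).
  near: z; apply: near_pull; rewrite yx.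
  by apply: open_nbhs_nbhs; split=> //; split.
rewrite !fctE FE // fct_sumE (horner_coef_wide _ (sP _)); apply/esym/eqP.
rewrite subr_eq0; apply/eqP/eq_bigr => k _.
by rewrite !fctE mulr1 mulrC.
Unshelve. all: end_near. Qed.

End CyclicSpan.

(** * The filtration by the degree in t *)

Section CyclicLength.
Context (R : realType) (X : funspace R) (M : line_bundle X) (d : nat).
Context (s : lb_idx (lb_pow M d) -> X -> R[i]).
Local Notation C := R[i].
Local Notation Y := (cyclic_cover s).
Local Notation proj := (cyclic_proj s).
Context (J : ideal_sheaf Y) (n : nat) (c : X -> lb_idx M).
Hypotheses (d_gt0 : (0 < d)%N) (cP : chart_choice c).
Hypothesis s_regular : forall i : lb_idx M, regular (lb_dom i) (s i).
Hypotheses (X1 : accessible_space X) (J_fin : zero_dim_subscheme J n).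
Local Notation t x := (@coord _ _ _ _ s (c x)).

Lemma cyclic_cover_accessible : accessible_space Y.
Proof. exact/subfunspace_accessible/total_space_accessible. Qed.
Let Y1 := cyclic_cover_accessible.

(** [E] is the product of [(t - t(z)) ^ n] over the other points z of the support in the fibre.
    Nilpotence puts the factor of z in the stalk at z, and [t] separates points of a fibre, so [E]
    is nonzero at [y]. *)
Lemma separating_polynomial y : exists E,
  [/\ polynomial_at J c (proj y) E, E y != 0 &
      forall z, proj z = proj y -> z <> y -> stalk J z E].
Proof.
have [l Vl] := (finite_seqP _).1 J_fin.1.
pose F z : Y -> C := (t (proj y) - cst (t (proj y) z)) ^+ n.
pose P (z : Y) := (proj z == proj y) && (z != y).
have pF z : polynomial_at J c (proj y) (F z).
  apply/polynomialX => //; apply: polynomialD; first exact: polynomial_t.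
  exact: (polynomial_cst J c d_gt0 (proj y) (- t (proj y) z)).
have pE r : polynomial_at J c (proj y) (\prod_(z <- r | P z) F z).
  apply: (big_ind (polynomial_at J c (proj y))).
  - exact: (polynomial_cst J c d_gt0 (proj y) 1).
  - by move=> ? ?; exact: polynomialM.
  - by move=> z _; exact: pF.
exists (\prod_(z <- l | P z) F z); split=> //.
  rewrite fct_prodE prodf_seq_neq0; apply/allP => z _.
  apply/implyP => /andP[/eqP zy zny].
  rewrite /F !fctE expf_eq0 negb_and subr_eq0; apply/orP; right.
  by apply: contra_neq zny => tyz; exact/esym/(coord_inj (esym zy) (cP _) tyz).
move=> z zy zny; have rE := (pE l).1 z zy.
have [Jz|/stalk_nonvanishing] := pselect (vanishing J z); last exact.
have zl : z \in l by move: Jz; rewrite Vl.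
rewrite (big_rem _ zl) /= {1}/P zy eqxx /=; case: eqP => //= _.
apply: stalkMr; last exact: (pE _).1.
apply: (stalk_nilpotent Y1 J_fin); last by rewrite !fctE subrr.
apply: germB; last exact: germ_cst.
by rewrite -zy; exact: germ_t.
Qed.

Lemma germ_fraction y (f : Y -> C) : stalk regular y f -> exists N F G,
  [/\ fibre_poly N F, fibre_poly N G, N (proj y), G (sub_incl _ y) != 0 &
      \forall z \near y, f z * G (sub_incl _ z) = F (sub_incl _ z)].
Proof.
move=> [U [oU Uy rf]]; have [V [g [oV Vy rg fg]]] := rf y Uy.
have [W [N [F [G [oW Wy fF fG gE]]]]] := rg _ Vy.
have [Ny Gy _] := gE _ Wy.
exists N, F, G; split=> //; rewrite -filter_of_nearI nbhsE.
exists (U `&` (sub_incl (cyclic_locus s) @^-1` (V `&` W))).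
  split; last by split.
  by apply: openI => //; apply: morphism_open; exact: openI.
move=> z [Uz [Vz Wz]] /=; have [_ Gz gz] := gE _ Wz.
by rewrite fg // gz divfK.
Qed.

(** With [f = F / G] near [y] and [W] inverting [E * G] modulo [J], the polynomial [F * W.[E * G] *
    E] equals [f] modulo [J] at [y], while its factor [E] kills it at the other points of the
    fibre. *)
Lemma spanned_point y f : stalk regular y f ->
  spanned J c d (proj y) (fun z => if z == y then f else 0).
Proof.
move=> rf; have [N [F [G [fF fG Ny Gy fGF]]]] := germ_fraction rf.
have [E [pE Ey EJ]] := separating_polynomial y.
have pF := polynomial_fibre_poly J d_gt0 cP s_regular fF Ny.
have pG := polynomial_fibre_poly J d_gt0 cP s_regular fG Ny.
set F' := fun _ => _ in pF; set G' := fun _ => _ in pG.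
have pu := polynomialM d_gt0 cP s_regular pE pG.
have [|W JW] := stalk_inverse Y1 J_fin (pu.1 y erefl).
  by rewrite fctE mulf_neq0.
have pW := polynomial_horner d_gt0 cP s_regular W pu.
have ph := polynomialM d_gt0 cP s_regular
  (polynomialM d_gt0 cP s_regular pF pW) pE.
apply: spanned_mod ph.2 _ => z zy; case: eqP => [->|zny].
  apply: stalk_near (stalkMl rf JW) _; near=> w.
  have fGFw : f w * G' w = F' w by near: w.
  rewrite !fctE -fGFw; ring.
rewrite sub0r; apply/stalkN/stalkMl; last exact: EJ.
by apply: germM; [exact: pF.1|exact: pW.1].
Unshelve. all: end_near. Qed.

(** The points of the finite support are added one at a time. Thus [1, t, ..., t^(d-1)] generate the
    algebra of Z over O_X. *)
Lemma spanned_all x h : (forall y, proj y = x -> stalk regular y (h y)) ->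
  spanned J c d x h.
Proof.
move=> rh; have [l Vl] := (finite_seqP _).1 J_fin.1.
suff hl (r : seq Y) : spanned J c d x (fun y => if y \in r then h y else 0).
  apply: spanned_mod (hl l) _ => y yx; case: ifPn => [_|nl].
    by rewrite subrr; exact: stalk0.
  rewrite subr0; apply: stalk_nonvanishing; last exact: rh.
  by rewrite Vl; exact/negP.
elim: r => [|z r IH].
  apply: spanned_mod (spanned0 J c d x) _ => y _.
  by rewrite subrr; exact: stalk0.
have [zr|zr] := boolP (z \in r).
  apply: spanned_mod IH _ => y _; rewrite inE.
  by case: eqP => [->|_]; rewrite ?zr subrr; exact: stalk0.
have [zx|zx] := eqVneq (proj z) x; last first.
  apply: spanned_mod IH _ => y yx; rewrite inE.
  have /negPf-> : y != z by apply: contra_neq zx => <-.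
  by rewrite subrr; exact: stalk0.
have := spanned_point (rh z zx); rewrite zx => /spannedD/(_ IH)/spanned_mod.
apply=> y _; rewrite inE; case: eqP => [->|_].
  by rewrite (negPf zr) addr0 subrr; exact: stalk0.
by rewrite add0r subrr; exact: stalk0.
Qed.

Definition step_germs q x : set (X -> C) := [set f | stalk regular x f /\
  spanned J c q x (fun _ => (f \o proj) * t x ^+ q)].

Lemma step_germ_ideal q x : germ_ideal x (step_germs q x).
Proof.
split.
- by move=> f [].
- move=> f g [rf hf] fg; split; first exact: germ_near rf fg.
  apply: spanned_mod hf _ => y yx; apply: stalk_near (stalk0 J y) _; near=> z.
  rewrite !fctE (_ : f (proj z) = g (proj z)) ?subrr //.
  by near: z; apply: (@near_pull _ _ _ _ _ y [set w | f w = g w]); rewrite yx.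
- split; first exact: (germ_cst x 0).
  apply: spanned_mod (spanned0 J c q x) _ => y _.
  apply: stalk_near (stalk0 J y) _; near=> z.
  by rewrite !fctE mul0r subrr.
- move=> f g [rf hf] [rg hg]; split; first exact: germD.
  apply: spanned_mod (spannedD hf hg) _ => y _.
  apply: stalk_near (stalk0 J y) _; near=> z.
  by rewrite !fctE -mulrDl subrr.
- move=> f g rf [rg hg]; split; first exact: germM.
  apply: spanned_mod (spannedZ rf hg) _ => y _.
  apply: stalk_near (stalk0 J y) _; near=> z.
  by rewrite !fctE mulrA subrr.
Unshelve. all: end_near. Qed.

(* I_q = {f | f t^q \in O_X + ... + O_X t^(q-1) in O_Z}, so that O_X/I_q is the
   q-th graded piece of the filtration of O_Z by the degree in t. *)
Definition step_ideal q := skyscraper_ideal (step_germ_ideal q).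

Lemma step_germs_out q x f : ~ (proj @` vanishing J) x ->
  stalk regular x f -> step_germs q x f.
Proof.
move=> nx rf; split=> //.
apply: spanned_mod (spanned0 J c q x) _ => y yx.
have nJy : ~ vanishing J y by move=> Jy; apply: nx; exists y.
apply: stalk_nonvanishing => //; rewrite subr0; apply: germM.
  by apply: germ_pull; rewrite yx.
by apply: germX; rewrite -yx; exact: germ_t.
Qed.

Lemma stalk_step q x f : stalk (step_ideal q) x f <-> step_germs q x f.
Proof.
apply: (stalk_skyscraper (step_germ_ideal q) _ (@step_germs_out q)) => //.
exact/finite_image/J_fin.1.
Qed.

Lemma finite_vanishing_step q : finite_set (vanishing (step_ideal q)).
Proof.
apply: sub_finite_set (finite_image proj J_fin.1).
apply: vanishing_skyscraper; last exact: X1; last exact: step_germs_out.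
exact/finite_image/J_fin.1.
Qed.

Lemma step_germsS p q x : (p <= q)%N -> step_germs p x `<=` step_germs q x.
Proof.
move=> /subnKC <- f; elim: (q - p)%N => [|r IH]; first by rewrite addn0.
move=> /IH[rf hf]; rewrite addnS; split=> //.
apply: spanned_mod (spanned_tM cP hf) _ => y yx.
by rewrite mulrCA -exprS subrr; exact: stalk0.
Qed.

(** If [m] families of germs independent modulo [I_q] had [(q + 1) m > n], their products with
    [1, ..., t^q] would be dependent modulo [J]. The top-degree part of a relation puts a nontrivial
    combination of them in some [I_j] with [j <= q], hence in [I_q]. *)
Lemma zero_dim_step q : exists2 l,
  (q.+1 * l <= n)%N & zero_dim_subscheme (step_ideal q) l.
Proof.
suff [l ln Al] : exists2 l, (l <= n %/ q.+1)%N &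
    quotient_dim (quotient_section (step_ideal q) setT)
      (quotient_zero (step_ideal q) setT) l.
  exists l; first by rewrite mulnC -leq_divRL.
  by split=> //; exact: finite_vanishing_step.
apply: quotient_dim_exists.
- by move=> x _; exact: stalk0.
- by move=> u v Bu Bv x _; apply: stalkD; [exact: Bu|exact: Bv].
- by move=> a u Bu x _; apply: stalkZ; exact: Bu.
move=> m f Af findep.
have {}Af r x : stalk regular x (f r x).
  have /(quotient_sectionE _ X1 (finite_vanishing_step q)) := Af r.
  by apply; first exact: openT.
rewrite leqNgt; apply/negP; rewrite ltn_divLR // => nm.
pose e (jr : 'I_q.+1 * 'I_m) : Y -> Y -> C^o :=
  fun y => (f jr.2 (proj y) \o proj) * t (proj y) ^+ jr.1.
have [a [[[j0 r0] a0] Ja]] : exists a : 'I_q.+1 * 'I_m -> C,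
    (exists jr, a jr != 0) /\ quotient_zero J setT (\sum_jr a jr *: e jr).
  apply: (quotient_dim_dependent _ _ _ J_fin.2); last first.
  - by rewrite card_prod !card_ord mulnC.
  - move=> [j r]; apply/quotient_sectionE => //; first exact: J_fin.1.
      exact: openT.
    move=> y _; apply: germM; first exact/germ_pull/Af.
    by apply: germX; exact: germ_t.
  - by move=> b u Bu x _; apply: stalkZ; exact: Bu.
  - by move=> u v Bu Bv x _; apply: stalkD; [exact: Bu|exact: Bv].
  - by move=> x _; exact: stalk0.
have exj : [exists r, a (j0, r) != 0] by apply/existsP; exists r0.
(* [j] is the highest power of [t] occurring in the relation. *)
have [j /existsP[r aj] jmax] := @arg_maxnP _ j0
  (fun j => [exists r, a (j, r) != 0]) (@nat_of_ord _) exj.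
pose b i x : X -> C := \sum_r cst (a (inord i, r)) * f r x.
have rb i x : stalk regular x (b i x).
  by apply: germ_sum => r' _; apply: germM => //; exact: germ_cst.
suff bK x : step_germs q x (b j x).
  move/eqP: aj; apply; apply: (findep (fun r => a (j, r))) => x _.
  apply/stalk_step; apply: (germ_ideal_near (step_germ_ideal q x) (bK x)).
  near=> z; rewrite /b !fct_sumE; apply: eq_bigr => r1 _.
  by rewrite !fctE inord_val.
have jq : (j <= q)%N by rewrite -ltnS.
apply: (step_germsS jq); split=> //.
(* By the relation, [b j x] times [t ^ j] is, modulo [J], the negative of the terms of degree below
   [j]. *)
have := spannedN (spanned_sum (fun i : 'I_j =>
  spanned_monomial J c (rb i x) (ltn_ord i))).
move=> /spanned_mod; apply=> y yx.
apply: stalk_near (Ja y I) _; near=> z.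
have -> : (\sum_jr a jr *: e jr) y z =
    \sum_i \sum_r (a (i, r) *: e (i, r)) y z.
  by rewrite !fct_sumE pair_bigA; apply: eq_bigr => -[].
have eE jr : e jr y = (f jr.2 x \o proj) * t x ^+ jr.1 by rewrite -yx.
pose T i := (b i x (proj z)) * t x z ^+ i.
have TE (i : 'I_q.+1) : \sum_r (a (i, r) *: e (i, r)) y z = T i.
  rewrite /T /b fct_sumE mulr_suml; apply: eq_bigr => r' _.
  by rewrite [_ y]scalrfctE eE !fctE /= inord_val -mulrA.
under eq_bigr do rewrite TE.
rewrite !fctE opprK fct_sumE -(big_mkord xpredT T).
rewrite (big_cat_nat (n := j)) //=; last by rewrite ltnW.
rewrite [X in _ + X]big_ltn // [X in _ + (_ + X)]big_nat_cond.
rewrite [X in _ + (_ + X)]big1 ?addr0.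
  rewrite addrC; congr (_ + _); rewrite big_mkord.
  by apply: eq_bigr => i _; rewrite /T !fctE.
move=> i; rewrite andbT => /andP[ji iq].
rewrite /T /b fct_sumE big1 ?mul0r // => r' _.
have /eqP-> : a (inord i, r') == 0; last by rewrite fctE mul0r.
apply: contraTT ji => ai; rewrite -leqNgt.
have := jmax (inord i); rewrite /= inordK //; apply.
by apply/existsP; exists r'.
Unshelve. all: end_near. Qed.

End CyclicLength.

(** * Lifting sections *)

(** For [n = a l + r] with [r < l], one has [tau n l - a = (a - 1)(l - 2) + (r + gamma n l - 1)];
    both summands are nonnegative, as [gamma n l = 1] when [r = 0]. *)
Lemma tau_ge (n l : nat) : (1 < l <= n)%N -> ((n %/ l)%N%:Z <= tau n l)%R.
Proof.
case: l => [|[|l]] //= ln; rewrite /tau /gamma /dvdn.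
have := divn_eq n l.+2; have := divn_gt0 n (ltn0Sn l.+1); rewrite ln.
case: (n %/ l.+2)%N => // a _; rewrite mulSn mulnSr mulnSr.
by case: eqP => /=; lia.
Qed.

(** For [q > 0] the default value [tau k.+1 q.+1] of the maximum is already at least the integral
    part of [(k + 1) / (q + 1)], which bounds [l]. *)
Lemma sigma_ge k d q l : (q <= k)%N -> (q.+1 * l <= k.+1)%N ->
  exists2 n : nat, n%:Z = sigma k d q + 1 & (l <= n)%N.
Proof.
move=> qk lk; rewrite /sigma; case: eqVneq => [q0|q0].
  by exists k.+1; rewrite ?q0 ?mul1n in lk *; lia.
rewrite subrK; set m := \big[_/_]_(_ <= _ < _) _.
have lm : (l%:Z <= m)%R.
  apply: le_trans (bigmax_ge_id _ _ _ _).
  apply: le_trans (tau_ge _); last by lia.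
  by rewrite lez_nat leq_divRL // mulnC.
by exists `|m|%N; lia.
Qed.

(** Locally [s] is [s'] divided by the invertible function that represents [phi]. *)
Lemma iso_maps_regular (R : realType) (X : funspace R) (L L' : line_bundle X)
    (phi : line_bundle_iso L L') s s' :
  iso_maps phi s s' -> global_section L' s' ->
  forall i, regular (lb_dom i) (s i).
Proof.
move=> ss' [rs' _] i; apply: regular_stalk => [|x xi]; first exact: lb_open.
have [j xj] := lb_cover L' x.
have oji : open (lb_dom j `&` lb_dom i) by apply: openI; exact: lb_open.
have rphi : stalk regular x (phi j i).
  by exists (lb_dom j `&` lb_dom i); split=> //; exact: iso_regular.
have rsj : stalk regular x (s' j).
  by exists (lb_dom j); split=> //; exact: lb_open.
have := germM (germV rphi (iso_neq0 phi xj xi)) rsj; move=> /germ_near; apply.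
near=> y.
have yi : lb_dom i y by near: y; exact: near_lb_dom.
have yj : lb_dom j y by near: y; exact: near_lb_dom.
by rewrite fctE (ss' j i) // mulKf // iso_neq0.
Unshelve. all: end_near. Qed.

(** In length 0 every regular germ lies in the ideal, so the zero section lifts everything; this
    serves for [q > k]. *)
Lemma separates_length0 (R : realType) (X : funspace R) (L : line_bundle X) J
    (c : X -> lb_idx L) :
  accessible_space X -> zero_dim_subscheme J 0 -> separates L J c.
Proof.
move=> X1 [fJ [e [_ eE]]] a ra.
exists (fun _ => 0); first exact: global_section0.
have [|b [Jb _]] := eE a; first by apply/quotient_sectionE => //; exact: openT.
move=> x; rewrite sub0r; apply: stalkN.
by have := Jb x I; rewrite big_ord0 subr0.
Qed.

(** * Lifting the coefficients of the powers of t in descending order *)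

Section CyclicDescent.
Context (R : realType) (X : funspace R) (M L : line_bundle X) (d : nat).
Context (s : lb_idx (lb_pow M d) -> X -> R[i]).
Local Notation C := R[i].
Local Notation Y := (cyclic_cover s).
Local Notation proj := (cyclic_proj s).
Context (J : ideal_sheaf Y) (n : nat) (c : X -> lb_idx M) (b : X -> lb_idx L).
Hypotheses (cP : chart_choice c) (bP : chart_choice b).
Hypotheses (X1 : accessible_space X) (J_fin : zero_dim_subscheme J n).
Local Notation LqM q := (lb_tensor L (lb_dual (lb_pow M q))).

(* The section (pi^* u) t^q of pi^* L, for a section u of L - qM. *)
Definition section_lift q (u : lb_idx (LqM q) -> X -> C)
    (i : lb_idx (lb_pullback proj L)) (z : Y) : C :=
  u (i, c (proj z)) (proj z) * coord (c (proj z)) z ^+ q.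

(** The transition functions of [M] enter [u] with exponent [-q] and the power of the coordinate
    with exponent [q], so any chart of [M] may be used. *)
Lemma section_liftE q u (i : lb_idx L) (j : lb_idx M) z :
  global_section (LqM q) u ->
  lb_dom i (proj z) -> lb_dom j (proj z) ->
  section_lift u i z = u (i, j) (proj z) * coord j z ^+ q.
Proof.
move=> [_ uE] zi zj; rewrite /section_lift.
rewrite (uE (i, c (proj z)) (i, j)); [|by split=> //; exact: cP|by split].
rewrite /= fctE lb_trans_id // mul1r (coord_trans (cP (proj z)) zj) exprMn.
by rewrite mulrACA mulVf ?mul1r // expf_neq0 // lb_neq0 //; exact: cP.
Qed.

Lemma near_section_lift q u (i : lb_idx L) (j : lb_idx M) y :
  global_section (LqM q) u ->
  lb_dom i (proj y) -> lb_dom j (proj y) ->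
  \forall z \near y,
    section_lift u i z = u (i, j) (proj z) * coord j z ^+ q.
Proof.
move=> gu yi yj; near=> z; apply: section_liftE => //.
  by near: z; apply: near_pull; exact: near_lb_dom.
by near: z; apply: near_pull; exact: near_lb_dom.
Unshelve. all: end_near. Qed.

Lemma global_section_lift q u : global_section (LqM q) u ->
  global_section (lb_pullback proj L) (section_lift u).
Proof.
move=> gu; split=> [i|i i' y yi yi'].
  apply: regular_stalk => [|y yi]; first exact: lb_open.
  have yc := cP (proj y).
  have ru : stalk regular y (u (i, c (proj y)) \o proj).
    apply: germ_pull; exists (@lb_dom _ _ L i `&` lb_dom (c (proj y))).
    split=> //; last exact: (gu.1 (i, c (proj y))).
    by apply: openI; exact: lb_open.
  have := germM ru (germX q (germ_coord yc)); move=> /germ_near; apply.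
  near=> z; rewrite !fctE; apply/esym.
  by near: z; exact: near_section_lift.
rewrite /section_lift (gu.2 (i, c (proj y)) (i', c (proj y))).
- by rewrite /= !fctE lb_trans_id ?expr1n ?invr1 ?mulr1 ?mulrA //; exact: cP.
- by split=> //; exact: cP.
- by split=> //; exact: cP.
Unshelve. all: end_near. Qed.

(** Induction on the degree bound: a section of [L - qM] matches the top coefficient modulo [I_q],
    and subtracting its lift leaves germs spanned by lower powers. *)
Lemma spanned_descent q (a : Y -> Y -> C) :
  (forall p, (p < q)%N ->
    separates (LqM p) (step_ideal J c p) (fun x => (b x, c x))) ->
  (forall x, spanned J c q x a) ->
  exists2 v, global_section (lb_pullback proj L) v &
    forall y, stalk J y (v (b (proj y)) - a y).
Proof.
elim: q a => [|q IH] a sep ha.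
  exists (fun _ => 0); first exact: global_section0.
  move=> y; rewrite sub0r; apply: stalkN.
  by have [e _ /(_ y erefl)] := ha (proj y); rewrite big_ord0 subr0.
have /choice[e eP] x : exists e : nat -> X -> C,
    (forall j, stalk regular x (e j)) /\ forall y, proj y = x ->
      stalk J y (a y - \sum_(j < q.+1) (e j \o proj) * coord (c x) ^+ j).
  by have [e re he] := ha x; exists e.
have [x|u gu ue] := sep q (ltnSn q) (fun x => e x q); first exact: (eP x).1.
pose a' y := a y - section_lift u (b (proj y)).
have [p pq|x|v gv va'] := IH a'.
- by apply: sep; rewrite ltnW.
(* The defect [u - e x q] lies in [I_q], so its product with [t ^ q] is absorbed by lower powers. *)
- have /(stalk_step cP X1 J_fin)[_ hq] := ue x.
  have lower : spanned J c q x
      (fun _ => \sum_(j < q) (e x j \o proj) * coord (c x) ^+ j).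
    by exists (e x) => [j|y _]; [exact: (eP x).1|rewrite subrr; exact: stalk0].
  apply: spanned_mod (spannedD lower (spannedN hq)) _ => y yx.
  apply: stalk_near ((eP x).2 y yx) _; near=> z.
  have -> : (a' y - (\sum_(j < q) (e x j \o proj) * coord (c x) ^+ j -
      ((u (b x, c x) - e x q) \o proj) * coord (c x) ^+ q)) z =
    a y z - section_lift u (b x) z -
    ((\sum_(j < q) (e x j \o proj) * coord (c x) ^+ j) z -
      (u (b x, c x) (proj z) - e x q (proj z)) * coord (c x) z ^+ q).
    by rewrite /a' yx !fctE.
  have -> : section_lift u (b x) z =
      u (b x, c x) (proj z) * coord (c x) z ^+ q.
    by near: z; apply: near_section_lift; rewrite ?yx.
  rewrite big_ord_recr /=.
  set S := \sum_(j < q) _.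
  rewrite [LHS](_ : _ =
    a y z - (S z + e x q (proj z) * coord (c x) z ^+ q)); last by rewrite !fctE.
  ring.
exists (fun i => v i + section_lift u i).
  by apply: global_sectionD => //; exact: global_section_lift.
by move=> y; have := va' y; rewrite /a' opprB addrA.
Unshelve. all: end_near. Qed.

End CyclicDescent.

Unset Implicit Arguments.
Theorem theorem3p1 (R : realType) (X : funspace R)
  (B : divisor X) (d : nat) (M : line_bundle X)
  (phi : line_bundle_iso (lb_pow M d) (lb_divisor B))
  (sB : lb_idx (lb_divisor B) -> X -> R[i])
  (s : lb_idx (lb_pow M d) -> X -> R[i])
  (L : line_bundle X) (k : nat) :
  smooth_projective_variety X ->
  smooth_divisor B ->
  (0 < d)%N ->
  global_section (lb_divisor B) sB ->
  divisor_of_zeros B (lb_divisor B) sB ->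
  iso_maps phi s sB ->
  (forall q : nat, (q <= minn k d.-1)%N ->
     k_very_ample (lb_tensor L (lb_dual (lb_pow M q))) (sigma k d q)) ->
  k_very_ample (lb_pullback (cyclic_proj s) L) k%:Z.
Proof.
move=> [pX _] _ d0 gsB _ ss Lq J n nk J_fin u tu.
have X1 := projective_variety_accessible pX.
have rs : forall i : lb_idx M, regular (lb_dom i) (s i).
  exact: iso_maps_regular ss gsB.
have /choice[c cP] := lb_cover M; have /choice[b bP] := lb_cover L.
have nE : n = k.+1 by apply/eqP; rewrite -eqz_nat nk; lia.
suff sep : separates (lb_pullback (cyclic_proj s) L) J (b \o cyclic_proj s).
  by apply: (separates_twisted_section _ sep tu) => y; exact: bP.
move=> a ra.
apply: (spanned_descent cP bP X1 J_fin (q := d)) => [q qd|x]; last first.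
  by apply: (spanned_all d0 cP rs X1 J_fin) => y _; exact: ra.
have [l ql Jl] := zero_dim_step cP X1 J_fin q; rewrite nE in ql.
have [qk|kq] := leqP q k; last first.
  (* For [q > k] the bound [(q + 1) l <= k + 1] leaves only [l = 0]. *)
  have l0 : l = 0%N by case: l ql {Jl} => // l; rewrite mulnS; lia.
  by apply: separates_length0 => //; rewrite -l0.
have bcP : @chart_choice _ _ (lb_tensor L (lb_dual (lb_pow M q)))
    (fun x => (b x, c x)) by move=> x; split; [exact: bP|exact: cP].
have [m mE lm] := sigma_ge d qk ql.
(* Enlarging the scheme of [I_q] to length [sigma k d q + 1] uses that [X] is infinite; a finite
   projective variety is a single point. *)
have [fX|nfX] := pselect (finite_set [set: X]).
  by apply: separates_point => //; exact: projective_variety_point.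
have [J' J'm J'J] := zero_dim_enlarge X1 nfX Jl lm.
apply: separates_sub J'J _.
apply: k_very_ample_separates X1 bcP _ mE J'm.
by apply: Lq; lia.
Qed.
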